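(* Let $n\ge2$, let $\varphi$ be a smooth positive function on $\mathbb{R}$ with $\operatorname{supp}\hat\varphi\subset(-1,1)$ and $\varphi(0)=1$, and for parameters $R\gg1$ and $D>0$ define $f_D$ on $\mathbb{R}^n$ by $$f_D(x)=e^{2\pi i Rx_1}\varphi(R^{1/2}x_1)\prod_{j=2}^n\varphi(x_j)\Big(\sum_{l_j\in\mathbb{Z},\ \frac{R}{2D}<l_j<\frac{R}{D}}e^{2\pi i Dl_jx_j}\Big),\qquad x=(x_1,\dots,x_n).$$ Let $0<c\ll1$ and let $q>0$ be an integer with $\frac{R}{Dq}\gg\sqrt{\ln q}$. Let $(p_1/q,\dots,p_n/q)$ be an admissible fraction and let $t=2p_1/(D^2q)$ satisfy $0<t\ll 1/R$. Let $E_{q,D}$ denote the set of $x\in\mathbb{R}^n$ with $$x_1\in \frac{2p_1R}{qD^2}+[-cR^{-1/2},cR^{-1/2}],\qquad x_j\in\frac{p_j}{Dq}+[-cR^{-1},cR^{-1}],\quad 2\le j\le n.$$ Then for every $x\in E_{q,D}\cap[0,c]^n$, $$\frac{|e^{it\hbar\Delta/2}f_D(x)|}{\|f_D\|_{L^2}}\gtrsim R^{1/4}\Big(\frac{R}{Dq}\Big)^{\frac{n-1}{2}}.$$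
   Context: $\hbar=1/(2\pi)$ and $e^{it\hbar\Delta/2}f(x)=\int\hat f(\xi)e^{i(-\pi t|\xi|^2+2\pi x\cdot\xi)}\,d\xi$ with $\hat f(\xi)=\int f(x)e^{-2\pi ix\cdot\xi}dx$. A point $(p_1/q,\dots,p_n/q)$ with $p_1,\dots,p_n,q\in\mathbb{Z}$ is an admissible fraction if $\gcd(p_1,q)=1$ and: $(p_2,\dots,p_n)\in\mathbb{Z}^{n-1}$ arbitrary when $q$ is odd; all $p_j$ ($2\le j\le n$) even when $q\equiv0\pmod4$; all $p_j$ ($2\le j\le n$) odd when $q\equiv2\pmod4$. Notation: $X\lesssim Y$ means $X\le CY$ for a constant $C>0$ independent of $R,D,q,p_j,t,x$; $X\gtrsim Y$ means $Y\lesssim X$; $X\ll Y$ means $X\le cY$ for a sufficiently small such constant, and $X\gg Y$ means $Y\ll X$.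
   Formalization: The condition R/(Dq) ≫ √(ln q) is read as R/(Dq) ≫ max(1, √(ln q)); this matters only for q = 1, where the literal condition is void and the sum over l_j can be empty (e.g. R = 2D), making f_D = 0 and the quotient undefined. *)

(* Defs.v *)
From Stdlib Require Import Reals ZArith List.
From Coquelicot Require Import Coquelicot.
Open Scope R_scope.

(* Points of R^n are functions nat -> R; coordinate x_{j+1} of the paper is (x j), j < n. *)

Definition upd (y : nat -> R) (k : nat) (s : R) : nat -> R :=
  fun j => if Nat.eqb j k then s else y j.

Definition Rint_line (g : R -> C) : C :=
  @RInt_gen C_R_CompleteNormedModule g (Rbar_locally m_infty) (Rbar_locally p_infty).

Fixpoint iint (k : nat) (F : (nat -> R) -> C) (y : nat -> R) : C :=
  match k with
  | O => F y
  | S k' => Rint_line (fun s => iint k' F (upd y k' s))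
  end.

Definition integral_Rn (n : nat) (F : (nat -> R) -> C) : C := iint n F (fun _ => 0).

Fixpoint dotn (n : nat) (x y : nat -> R) : R :=
  match n with O => 0 | S m => dotn m x y + x m * y m end.

Definition expi (th : R) : C := (cos th, sin th).

Definition fourier (n : nat) (f : (nat -> R) -> C) (xi : nat -> R) : C :=
  integral_Rn n (fun x => Cmult (f x) (expi (- 2 * PI * dotn n x xi))).

Definition schrod (n : nat) (t : R) (f : (nat -> R) -> C) (x : nat -> R) : C :=
  integral_Rn n (fun xi => Cmult (fourier n f xi)
                   (expi (- PI * t * dotn n xi xi + 2 * PI * dotn n x xi))).

Definition L2norm (n : nat) (f : (nat -> R) -> C) : R :=
  sqrt (fst (integral_Rn n (fun x => RtoC (Cmod (f x) ^ 2)))).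

Fixpoint Cprod_upto (g : nat -> C) (k : nat) : C :=
  match k with O => RtoC 1 | S m => Cmult (Cprod_upto g m) (g m) end.

(* sum over integers l with a < l < b of g l, for 0 <= a (only l >= 0 can occur);
   the candidates 0 .. up b - 1 contain all such l. *)
Definition Zsum_open (a b : R) (g : Z -> C) : C :=
  fold_right Cplus (RtoC 0)
    (map (fun k => let l := Z.of_nat k in
                   if Rlt_dec a (IZR l) then
                     if Rlt_dec (IZR l) b then g l else RtoC 0
                   else RtoC 0)
         (seq 0 (Z.to_nat (up b)))).

Definition fD (n : nat) (phi : R -> R) (Rp D : R) (x : nat -> R) : C :=
  Cmult (Cmult (expi (2 * PI * Rp * x 0%nat)) (RtoC (phi (sqrt Rp * x 0%nat))))
        (Cprod_upto (fun j =>
           Cmult (RtoC (phi (x (S j))))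
                 (Zsum_open (Rp / (2 * D)) (Rp / D)
                    (fun l => expi (2 * PI * D * IZR l * x (S j))))) (n - 1)).

Definition fourier1 (phi : R -> R) (xi : R) : C :=
  fourier 1 (fun x => RtoC (phi (x 0%nat))) (fun _ => xi).

(* Hypotheses on phi: smooth, positive, integrable (so \hat phi is defined),
   supp \hat phi contained in (-1,1) (compactly), phi(0) = 1. *)
Definition phi_hyp (phi : R -> R) : Prop :=
  (forall (k : nat) (x : R), ex_derive_n phi k x) /\
  (forall x, 0 < phi x) /\
  ex_RInt_gen phi (Rbar_locally m_infty) (Rbar_locally p_infty) /\
  (exists a, a < 1 /\ forall xi, a < Rabs xi -> fourier1 phi xi = RtoC 0) /\
  phi 0 = 1.

(* admissible fraction (p_1/q, ..., p_n/q); p_{j+1} is (p j) *)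
Definition admissible (n : nat) (p : nat -> Z) (q : Z) : Prop :=
  Z.gcd (p 0%nat) q = 1%Z /\
  ((Z.modulo q 4 = 0)%Z -> forall j, (1 <= j < n)%nat -> Z.even (p j) = true) /\
  ((Z.modulo q 4 = 2)%Z -> forall j, (1 <= j < n)%nat -> Z.odd (p j) = true).

Definition in_E (n : nat) (c Rp D : R) (q : Z) (p : nat -> Z) (x : nat -> R) : Prop :=
  Rabs (x 0%nat - 2 * IZR (p 0%nat) * Rp / (IZR q * D ^ 2)) <= c / sqrt Rp /\
  forall j, (1 <= j < n)%nat -> Rabs (x j - IZR (p j) / (D * IZR q)) <= c / Rp.

Definition in_cube (n : nat) (c : R) (x : nat -> R) : Prop :=
  forall j, (j < n)%nat -> 0 <= x j <= c.

(* Main.v *)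
(** Both the Fourier transform of [f_D] and the propagator factor over the
    coordinates, so everything reduces to one-dimensional integrals against
    [fourier1 phi], which is continuous and supported in (-1, 1).

    In [x_1] the phase of the resulting integral is small on [E], so the integral
    is close to [int (fourier1 phi) = phi 0 = 1].  In [x_j], [j >= 2], one gets
    [sum_l a_l v_l] with [a_l = e((- p_1 l^2 + p_j l) / q)] and slowly varying
    [v_l] close to 1; by Abel summation it is comparable with [sum_l a_l].  That
    sum consists of about [R / (D q)] complete Gauss sums, of modulus [sqrt q] or
    [sqrt (2 q)] by the parity conditions, and of an incomplete block which Weyl
    differencing bounds by [O (sqrt (q (1 + ln q)))]; this is where
    [R / (D q) >> sqrt (ln q)] enters.

    For the norm, [0 < t << 1 / R] forces [D >= 2], so the translates of the
    support of [fourier1 phi] by multiples of [D] are disjoint and the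
    exponentials [e(D l x)] are orthogonal with respect to [phi^2 dx].  The
    inversion formula for [phi] is obtained with the weights [exp (- eps |xi|)],
    whose transform is the Poisson kernel, with total mass given by [atan]. *)

Require Import Defs.
From Stdlib Require Import Reals ZArith Lra Lia Psatz List Permutation FunctionalExtensionality.
From Coquelicot Require Import Coquelicot.
Open Scope R_scope.

(** * Complex-valued integrals on the line *)

(** A termwise estimate in [x_j] would fail: replacing every [v_l] by 1 costs about
    [c R / D = c q Y], with [Y = R / (D q)], while the main term has size [sqrt q * Y]. Abel
    summation instead charges the error to partial sums, which are no larger than the main term up
    to a constant. Per coordinate the numerator is then [sqrt q * Y] and the norm [sqrt (q Y)], up
    to constants; [q] cancels and [sqrt Y] remains. On the analytic side, [phi] comes with neither a
    bound nor a rate of decay. Positivity makes [phi] its own dominating function: the tail of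
    [phi(x) e(k x)] is at most the missing mass of [phi], uniformly in [k]. Integrals are therefore
    exchanged on rectangles only, and each truncation is paid for in missing mass. Boundedness of
    [phi], hence integrability of [phi^2], is a consequence of inversion. In the hypothesis on [Y],
    the maximum with 1 keeps [Y] large also when [ln q] is small, so that incomplete periods stay
    negligible. *)

Notation CV := C_R_CompleteNormedModule.
Definition ccont (g : R -> C) : Prop := forall x : R, continuous (g : R -> CV) x.
Definition CI (g : R -> C) (a b : R) : C := @RInt CV g a b.
(** The relational form carries convergence along with the value; [Rint_line] returns some value
    even for a divergent integral. *)
Definition lineint (g : R -> C) (I : C) : Prop :=
  @is_RInt_gen CV g (Rbar_locally m_infty) (Rbar_locally p_infty) I.

Lemma Ceq (z w : C) : fst z = fst w -> snd z = snd w -> z = w.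
Proof. destruct z, w; simpl; intros; subst; reflexivity. Qed.

Lemma ccont_pair (f g : R -> R) :
  (forall x, continuous f x) -> (forall x, continuous g x) -> ccont (fun x => (f x, g x)).
Proof.
  intros Hf Hg x.
  apply (continuous_comp_2 f g (fun u v => (u, v) : CV)); auto.
  apply continuous_ext with (f := fun z : R * R => z).
  - intros [u v]; reflexivity.
  - apply continuous_id.
Qed.

Lemma ccont_fst (g : R -> C) : ccont g -> forall x, continuous (fun x => fst (g x)) x.
Proof.
  intros H x. apply (continuous_comp (U := R_UniformSpace) (V := CV) (W := R_UniformSpace) g fst).
  - apply H.
  - destruct (g x) as [u v]. apply (continuous_fst (U := R_UniformSpace) (V := R_UniformSpace)).
Qed.

Lemma ccont_snd (g : R -> C) : ccont g -> forall x, continuous (fun x => snd (g x)) x.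
Proof.
  intros H x. apply (continuous_comp (U := R_UniformSpace) (V := CV) (W := R_UniformSpace) g snd).
  - apply H.
  - destruct (g x) as [u v]. apply (continuous_snd (U := R_UniformSpace) (V := R_UniformSpace)).
Qed.

Lemma ccont_ext (f g : R -> C) : (forall x, f x = g x) -> ccont f -> ccont g.
Proof. intros E H x. apply continuous_ext with (f := f); auto. Qed.

Lemma ccont_RtoC (f : R -> R) : (forall x, continuous f x) -> ccont (fun x => RtoC (f x)).
Proof. intros H. apply ccont_pair; auto. intros; apply continuous_const. Qed.

Lemma ccont_const (c : C) : ccont (fun _ => c).
Proof. intros x; apply continuous_const. Qed.

Lemma ccont_plus (f g : R -> C) : ccont f -> ccont g -> ccont (fun x => Cplus (f x) (g x)).
Proof. intros Hf Hg x. apply (continuous_plus (V := CV) f g); auto. Qed.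

Lemma ccont_mult (f g : R -> C) : ccont f -> ccont g -> ccont (fun x => Cmult (f x) (g x)).
Proof.
  intros Hf Hg.
  apply ccont_ext with (f := fun x => (fst (f x) * fst (g x) - snd (f x) * snd (g x),
                                      fst (f x) * snd (g x) + snd (f x) * fst (g x))).
  { reflexivity. }
  apply ccont_pair; intros x.
  - apply (continuous_minus (V := R_NormedModule));
      apply (continuous_mult (K := R_AbsRing)); auto using ccont_fst, ccont_snd.
  - apply (continuous_plus (V := R_NormedModule));
      apply (continuous_mult (K := R_AbsRing)); auto using ccont_fst, ccont_snd.
Qed.

Lemma ccont_expi (th : R -> R) : (forall x, continuous th x) -> ccont (fun x => expi (th x)).
Proof.
  intros H. apply ccont_pair; intros x.
  - apply continuous_comp; auto. apply continuity_pt_filterlim, continuity_cos.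
  - apply continuous_comp; auto. apply continuity_pt_filterlim, continuity_sin.
Qed.

Lemma ccont_comp (g : R -> C) (f : R -> R) :
  ccont g -> (forall x, continuous f x) -> ccont (fun x => g (f x)).
Proof. intros Hg Hf x. apply (continuous_comp f g); auto. Qed.

(** * Unit complex exponentials *)

Lemma expi_plus a b : expi (a + b) = Cmult (expi a) (expi b).
Proof. unfold expi, Cmult; simpl. rewrite cos_plus, sin_plus. f_equal; ring. Qed.

Lemma expi_0 : expi 0 = RtoC 1.
Proof. unfold expi. rewrite cos_0, sin_0. easy. Qed.

Lemma Cmod_expi a : Cmod (expi a) = 1.
Proof.
  unfold expi, Cmod; simpl. transitivity (sqrt 1); [f_equal | apply sqrt_1].
  generalize (sin2_cos2 a). unfold Rsqr. lra.
Qed.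

Lemma sin_abs_le x : Rabs (sin x) <= Rabs x.
Proof.
  assert (P : forall y, 0 <= y -> Rabs (sin y) <= y).
  { intros y Hy. destruct (Req_dec y 0) as [->|Hn].
    - rewrite sin_0, Rabs_R0; lra.
    - destruct (Rle_dec y 1).
      + rewrite Rabs_right. left; apply sin_lt_x; lra.
        apply Rle_ge, sin_ge_0; try lra. generalize PI2_1; lra.
      + apply Rle_trans with 1; [|lra]. apply Rabs_le. generalize (SIN_bound y); lra. }
  destruct (Rle_dec 0 x).
  - rewrite (Rabs_right x); [|lra]. auto.
  - rewrite (Rabs_left x); [|lra]. rewrite <- (Rabs_Ropp (sin x)), <- sin_neg. apply P; lra.
Qed.

(** With half-difference [u] and half-sum [v] of the angles, the difference is [2 i sin u] times
    [expi v]. *)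
Lemma expi_chord a b : Cmod (Cminus (expi a) (expi b)) = 2 * Rabs (sin ((a - b) / 2)).
Proof.
  assert (P : forall u v, Cmod (Cminus (expi (u + v)) (expi (v - u))) = 2 * Rabs (sin u)).
  { intros u v. transitivity (Rabs (2 * sin u)).
    2:{ rewrite Rabs_mult, (Rabs_right 2) by lra. reflexivity. }
    rewrite <- sqrt_Rsqr_abs. unfold expi, Cminus, Cplus, Copp, Cmod; simpl. f_equal. unfold Rsqr.
    rewrite cos_plus, sin_plus, cos_minus, sin_minus.
    generalize (sin2_cos2 v). unfold Rsqr. intros E.
    transitivity (4 * (sin u * sin u) * (sin v * sin v + cos v * cos v)); [|rewrite E]; ring. }
  rewrite <- (P _ ((a + b) / 2)). do 3 f_equal; field.
Qed.

Lemma expi_lip a b : Cmod (Cminus (expi a) (expi b)) <= Rabs (a - b).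
Proof.
  rewrite expi_chord. generalize (sin_abs_le ((a - b) / 2)).
  unfold Rdiv. rewrite Rabs_mult, (Rabs_right (/ 2)) by lra. lra.
Qed.

(** * Complex integrals over compact intervals *)

Lemma CI_is (g : R -> C) a b : ccont g -> @is_RInt CV g a b (CI g a b).
Proof.
  intros H. apply (RInt_correct (V := CV)). apply (ex_RInt_continuous (V := CV)).
  intros z _. apply H.
Qed.

Lemma CI_unique (g : R -> C) a b l : @is_RInt CV g a b l -> CI g a b = l.
Proof. apply (is_RInt_unique (V := CV)). Qed.

Lemma is_RInt_C (g : R -> C) a b (l : C) :
  @is_RInt R_NormedModule (fun x => fst (g x)) a b (fst l) ->
  @is_RInt R_NormedModule (fun x => snd (g x)) a b (snd l) -> @is_RInt CV g a b l.
Proof.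
  intros H1 H2. destruct l as [u v].
  apply (is_RInt_fct_extend_pair (U := R_NormedModule) (V := R_NormedModule) g a b u v); auto.
Qed.

Lemma is_RInt_C_fst (g : R -> C) a b (l : C) :
  @is_RInt CV g a b l -> @is_RInt R_NormedModule (fun x => fst (g x)) a b (fst l).
Proof. apply (is_RInt_fct_extend_fst (U := R_NormedModule) (V := R_NormedModule)). Qed.

Lemma is_RInt_C_snd (g : R -> C) a b (l : C) :
  @is_RInt CV g a b l -> @is_RInt R_NormedModule (fun x => snd (g x)) a b (snd l).
Proof. apply (is_RInt_fct_extend_snd (U := R_NormedModule) (V := R_NormedModule)). Qed.

Lemma is_RInt_Cmult (c : C) (g : R -> C) a b (l : C) :
  @is_RInt CV g a b l -> @is_RInt CV (fun x => Cmult c (g x)) a b (Cmult c l).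
Proof.
  intros H. generalize (is_RInt_C_fst _ _ _ _ H) (is_RInt_C_snd _ _ _ _ H). intros H1 H2.
  apply is_RInt_C; simpl.
  - apply (is_RInt_minus (V := R_NormedModule) (fun x => fst c * fst (g x)) (fun x => snd c * snd (g x)));
    apply (is_RInt_scal (V := R_NormedModule)); auto.
  - apply (is_RInt_plus (V := R_NormedModule) (fun x => fst c * snd (g x)) (fun x => snd c * fst (g x)));
    apply (is_RInt_scal (V := R_NormedModule)); auto.
Qed.

Lemma CI_mult c g a b : ccont g -> CI (fun x => Cmult c (g x)) a b = Cmult c (CI g a b).
Proof. intros H. apply CI_unique, is_RInt_Cmult, CI_is, H. Qed.

Lemma CI_minus f g a b : ccont f -> ccont g ->
  CI (fun x => Cminus (f x) (g x)) a b = Cminus (CI f a b) (CI g a b).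
Proof.
  intros Hf Hg. apply CI_unique.
  apply (is_RInt_minus (V := CV) f g); apply CI_is; auto.
Qed.

Lemma CI_Chasles g a b c : ccont g -> Cplus (CI g a b) (CI g b c) = CI g a c.
Proof.
  intros H. symmetry. apply CI_unique.
  apply (is_RInt_Chasles (V := CV) g a b c); apply CI_is; auto.
Qed.

Lemma CI_ext f g a b : (forall x, Rmin a b < x < Rmax a b -> f x = g x) -> CI f a b = CI g a b.
Proof. apply (RInt_ext (V := CV)). Qed.

Lemma CI_le (g : R -> C) (h : R -> R) a b : a <= b -> ccont g -> (forall x, continuous h x) ->
  (forall x, a <= x <= b -> Cmod (g x) <= h x) -> Cmod (CI g a b) <= RInt h a b.
Proof.
  intros Hab Hg Hh H. rewrite Cmod_norm.
  apply (norm_RInt_le (V := CV) g h a b); auto.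
  - intros x Hx. specialize (H x Hx). rewrite Cmod_norm in H. exact H.
  - apply CI_is; auto.
  - apply (RInt_correct (V := R_CompleteNormedModule)), (ex_RInt_continuous (V := R_CompleteNormedModule)); auto.
Qed.

Lemma CI_le_const (g : R -> C) a b M : a <= b -> ccont g ->
  (forall x, a <= x <= b -> Cmod (g x) <= M) -> Cmod (CI g a b) <= (b - a) * M.
Proof.
  intros Hab Hg H. rewrite Cmod_norm.
  apply (norm_RInt_le_const (V := CV) g a b); auto.
  - intros x Hx. specialize (H x Hx). rewrite Cmod_norm in H. exact H.
  - apply CI_is; auto.
Qed.

Lemma RI_is (g : R -> R) a b : (forall x, continuous g x) -> @is_RInt R_NormedModule g a b (RInt g a b).
Proof.
  intros H. apply (RInt_correct (V := R_CompleteNormedModule)), (ex_RInt_continuous (V := R_CompleteNormedModule)); auto.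
Qed.

(** * Improper integrals by explicit truncation *)

Lemma lineint_unique g I : lineint g I -> Rint_line g = I.
Proof.
  intros H. unfold Rint_line.
  apply (is_RInt_gen_unique (V := CV)); auto.
Qed.

Lemma ball_C_Cmod (x y : C) (eps : R) : Cmod (Cminus y x) < eps -> @ball CV x eps y.
Proof. intros H. apply (C_NormedModule_mixin_compat1 x y eps). exact H. Qed.

(** Balls of [CV] are squares, from the product structure, so passing to the modulus costs a factor
    [sqrt 2]. *)
Lemma Cmod_ball_C (x y : C) (eps : posreal) : @ball CV x eps y -> Cmod (Cminus y x) < sqrt 2 * eps.
Proof. intros H. exact (C_NormedModule_mixin_compat2 x y eps H). Qed.

Lemma lineint_intro g I : ccont g ->
  (forall eps, 0 < eps -> exists A, forall a b, a <= - A -> A <= b -> Cmod (Cminus (CI g a b) I) <= eps) ->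
  lineint g I.
Proof.
  intros Hc H P [eps HP].
  destruct (H (eps / 2)) as [A HA]. { generalize (cond_pos eps); lra. }
  apply Filter_prod with (Q := fun a => a < - A) (R := fun b => A < b).
  - exists (- A). auto.
  - exists A. auto.
  - intros a b Ha Hb. exists (CI g a b). split.
    + apply CI_is; auto.
    + apply HP. apply ball_C_Cmod. simpl. specialize (HA a b). generalize (cond_pos eps). simpl in *. lra.
Qed.

Lemma lineint_elim g I : lineint g I ->
  forall eps, 0 < eps -> exists A, 0 < A /\ forall a b, a <= - A -> A <= b -> Cmod (Cminus (CI g a b) I) <= eps.
Proof.
  intros H eps He.
  assert (He2 : 0 < eps / 2) by lra.
  specialize (H (fun y => @ball CV I (mkposreal _ He2) y)).
  destruct H as [Q1 Q2 [A1 H1] [A2 H2] HQ].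
  { exists (mkposreal _ He2). auto. }
  exists (Rmax 1 (Rmax (1 - A1) (1 + A2))). split.
  { generalize (Rmax_l 1 (Rmax (1 - A1) (1 + A2))); lra. }
  intros a b Ha Hb.
  generalize (Rmax_r 1 (Rmax (1 - A1) (1 + A2))) (Rmax_l (1 - A1) (1 + A2)) (Rmax_r (1 - A1) (1 + A2)). intros M0 M1 M2.
  destruct (HQ a b) as [y [Hy1 Hy2]].
  - apply H1. lra.
  - apply H2. lra.
  - simpl in Hy1. rewrite (CI_unique _ _ _ _ Hy1).
    apply Cmod_ball_C in Hy2. simpl in Hy2.
    assert (sqrt 2 <= 2). { rewrite <- (sqrt_Rsqr 2) at 2 by lra. apply sqrt_le_1_alt. unfold Rsqr; lra. }
    nra.
Qed.

Lemma lineint_ext f g I : (forall x, f x = g x) -> lineint f I -> lineint g I.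
Proof.
  intros E H. replace g with f; auto. apply functional_extensionality; auto.
Qed.

Lemma lineint_plus f g I J : lineint f I -> lineint g J -> lineint (fun x => Cplus (f x) (g x)) (Cplus I J).
Proof. intros Hf Hg. exact (is_RInt_gen_plus (V := CV) f g I J Hf Hg). Qed.

Lemma CI_0 a b : CI (fun _ => RtoC 0) a b = RtoC 0.
Proof.
  apply CI_unique.
  assert (H : is_RInt (V := R_NormedModule) (fun _ => 0) a b 0).
  { generalize (is_RInt_const (V := R_NormedModule) a b 0).
    unfold scal; simpl; unfold mult; simpl. rewrite Rmult_0_r; auto. }
  apply is_RInt_C; exact H.
Qed.

Lemma lineint_0 : lineint (fun _ => RtoC 0) (RtoC 0).
Proof.
  apply lineint_intro. { apply ccont_const. }
  intros eps He. exists 0. intros a b _ _.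
  rewrite CI_0. replace (Cminus 0 0) with (RtoC 0) by ring. rewrite Cmod_0; lra.
Qed.

(** [CV] is a module over the reals, so a complex constant is not one of its scalars; continuity of
    the multiplication is used directly. The [1 + Cmod c] in the radius covers [c = 0]. *)
Lemma lineint_mult c g I : lineint g I -> lineint (fun x => Cmult c (g x)) (Cmult c I).
Proof.
  intros H P HP.
  assert (HP' : locally (I : CV) (fun y => P (Cmult c y))).
  { destruct HP as [eps HP].
    assert (Hd : 0 < eps / (sqrt 2 * (1 + Cmod c))).
    { apply Rdiv_lt_0_compat. apply cond_pos. apply Rmult_lt_0_compat. apply sqrt_lt_R0; lra.
      generalize (Cmod_ge_0 c); lra. }
    exists (mkposreal _ Hd). intros y Hy. apply HP. apply ball_C_Cmod.
    apply Cmod_ball_C in Hy. simpl in Hy.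
    replace (Cminus (Cmult c y) (Cmult c I)) with (Cmult c (Cminus y I)) by ring.
    rewrite Cmod_mult.
    assert (0 < sqrt 2) by (apply sqrt_lt_R0; lra).
    generalize (Cmod_ge_0 c) (Cmod_ge_0 (Cminus y I)). intros.
    apply Rle_lt_trans with ((1 + Cmod c) * Cmod (Cminus y I)). nra.
    apply Rlt_le_trans with ((1 + Cmod c) * (sqrt 2 * (eps / (sqrt 2 * (1 + Cmod c))))).
    apply Rmult_lt_compat_l; lra.
    right. field. split; lra. }
  destruct (H _ HP') as [Q1 Q2 H1 H2 HQ].
  apply Filter_prod with Q1 Q2; auto.
  intros a b Ha Hb. destruct (HQ a b Ha Hb) as [y [Hy1 Hy2]].
  exists (Cmult c y). split; auto. apply is_RInt_Cmult; auto.
Qed.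

Lemma lineint_compact g c d : ccont g -> c <= d -> (forall x, x < c \/ d < x -> g x = RtoC 0) ->
  lineint g (CI g c d).
Proof.
  intros Hg Hcd H0. apply lineint_intro; auto.
  intros eps He. exists (Rmax (- c) d). intros a b Ha Hb.
  generalize (Rmax_l (- c) d) (Rmax_r (- c) d). intros.
  assert (Z : forall u v, u <= v -> (v <= c \/ d <= u) -> CI g u v = RtoC 0).
  { intros u v Huv Hd. rewrite (CI_ext g (fun _ => RtoC 0)).
    - apply CI_0.
    - intros x. rewrite Rmin_left, Rmax_right by lra. intros. apply H0. lra. }
  rewrite <- (CI_Chasles g a c b), <- (CI_Chasles g c d b) by auto.
  rewrite (Z a c), (Z d b) by lra.
  match goal with |- Cmod ?z <= _ => replace z with (RtoC 0) by ring end.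
  rewrite Cmod_0; lra.
Qed.

Lemma CI_comp_lin g s m a b : 0 < s -> ccont g ->
  CI (fun x => g (s * x + m)) a b = Cmult (RtoC (/ s)) (CI g (s * a + m) (s * b + m)).
Proof.
  intros Hs Hg.
  assert (E := RInt_comp_lin (V := CV) g s m a b).
  fold (CI g (s * a + m) (s * b + m)) in E. rewrite <- E.
  2:{ exists (CI g (s * a + m) (s * b + m)). apply CI_is; auto. }
  rewrite <- CI_mult.
  - apply CI_ext. intros x _. apply Ceq; simpl; unfold scal; simpl; unfold mult; simpl; field; lra.
  - apply ccont_ext with (f := fun x => Cmult (RtoC s) (g (s * x + m))).
    + intros x. apply Ceq; simpl; unfold scal; simpl; unfold mult; simpl; ring.
    + apply ccont_mult. apply ccont_const. apply ccont_comp; auto.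
      intros x. apply (ex_derive_continuous (V := R_NormedModule)). auto_derive; auto.
Qed.

Lemma lineint_comp_lin g I s m : 0 < s -> ccont g -> lineint g I ->
  lineint (fun x => g (s * x + m)) (Cmult (RtoC (/ s)) I).
Proof.
  intros Hs Hg H. apply lineint_intro.
  { apply ccont_comp; auto. intros x. apply (ex_derive_continuous (V := R_NormedModule)). auto_derive; auto. }
  intros eps He.
  destruct (lineint_elim g I H (eps * s)) as [A [HA0 HA]]. { apply Rmult_lt_0_compat; auto. }
  exists ((A + Rabs m) / s). intros a b Ha Hb.
  rewrite CI_comp_lin by auto.
  match goal with |- Cmod ?z <= _ => replace z with
    (Cmult (RtoC (/ s)) (Cminus (CI g (s * a + m) (s * b + m)) I)) by ring end.
  rewrite Cmod_mult, Cmod_R, Rabs_right.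
  2:{ apply Rle_ge. left. apply Rinv_0_lt_compat; auto. }
  apply Rmult_le_reg_l with s; auto. rewrite <- Rmult_assoc, Rinv_r, Rmult_1_l by lra.
  rewrite (Rmult_comm s eps). apply HA.
  - generalize (Rle_abs m). intros. assert (s * a <= - (A + Rabs m)).
    { apply Rle_trans with (s * - ((A + Rabs m) / s)). apply Rmult_le_compat_l; lra. right; field; lra. }
    lra.
  - generalize (Rle_abs (- m)). rewrite Rabs_Ropp. intros. assert (A + Rabs m <= s * b).
    { apply Rle_trans with (s * ((A + Rabs m) / s)). right; field; lra. apply Rmult_le_compat_l; lra. }
    lra.
Qed.

(** * Exchanging integrals over rectangles *)

Lemma continuity_2d_slice2 (f : R -> R -> R) x y :
  continuity_2d_pt f x y -> continuous (fun v => f x v) y.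
Proof.
  intros H. apply continuity_pt_filterlim, continuity_pt_locally.
  intros eps. destruct (H eps) as [d Hd]. exists d. intros v Hv.
  apply Hd; auto. rewrite Rminus_diag, Rabs_R0. apply cond_pos.
Qed.

Lemma continuity_2d_slice1 (f : R -> R -> R) x y :
  continuity_2d_pt f x y -> continuous (fun u => f u y) x.
Proof.
  intros H. apply continuity_pt_filterlim, continuity_pt_locally.
  intros eps. destruct (H eps) as [d Hd]. exists d. intros v Hv.
  apply Hd; auto. rewrite Rminus_diag, Rabs_R0. apply cond_pos.
Qed.

(** Continuity is uniform on the compact segment [[a, b]] at height [y]; the [1 +] in the tolerance
    covers [a = b]. *)
Lemma RInt_param_continuous (f : R -> R -> R) a b :
  (forall x y, continuity_2d_pt f x y) -> a <= b ->
  forall y, continuous (fun y => RInt (fun x => f x y) a b) y.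
Proof.
  intros Hf Hab y. apply continuity_pt_filterlim, continuity_pt_locally.
  intros eps.
  assert (He : 0 < eps / (1 + (b - a))). { apply Rdiv_lt_0_compat. apply cond_pos. lra. }
  destruct (uniform_continuity_2d_1d f a b y (fun x _ => Hf x y) (mkposreal _ He)) as [d Hd].
  simpl in Hd. exists d. intros v Hv.
  assert (Hc : forall y x, continuous (fun x => f x y) x) by (intros; apply continuity_2d_slice1; auto).
  assert (E : Rabs (RInt (fun x => f x v) a b - RInt (fun x => f x y) a b) <= (b - a) * (eps / (1 + (b - a)))).
  { apply (norm_RInt_le_const (V := R_NormedModule) (fun x => f x v - f x y) a b); auto.
    - intros x Hx. left. change (Rabs (f x v - f x y) < eps / (1 + (b - a))).
      change (Rabs (v - y) < d) in Hv. generalize (cond_pos d). intros.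
      apply Hd; try lra.
      + apply Rabs_def2 in Hv; lra.

      + rewrite Rminus_diag, Rabs_R0; lra.
    - apply (is_RInt_minus (V := R_NormedModule)); apply RI_is; auto. }
  eapply Rle_lt_trans. exact E.
  generalize (cond_pos eps); intros.
  apply Rmult_lt_reg_r with (1 + (b - a)). lra.
  replace ((b - a) * (eps / (1 + (b - a))) * (1 + (b - a))) with ((b - a) * eps) by (field; lra). nra.
Qed.

(* Both sides vanish for b = a and have the same derivative in b. *)
Lemma Fubini_rect (f : R -> R -> R) a b c d :
  (forall x y, continuity_2d_pt f x y) -> a <= b -> c <= d ->
  RInt (fun y => RInt (fun x => f x y) a b) c d = RInt (fun x => RInt (fun y => f x y) c d) a b.
Proof.
  intros Hf Hab Hcd.
  assert (Hc1 : forall y x, continuous (fun x => f x y) x) by (intros; apply continuity_2d_slice1; auto).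
  assert (Hc2 : forall x y, continuous (fun y => f x y) y) by (intros; apply continuity_2d_slice2; auto).
  set (f' := fun y x => f x y).
  assert (Hf' : forall x y, continuity_2d_pt f' x y).
  { intros x y eps. destruct (Hf y x eps) as [e He]. exists e. intros u v Hu Hv. apply He; auto. }
  assert (Dx : forall z y, is_derive (fun z => RInt (fun x => f x y) a z) z (f z y)).
  { intros z y. apply (is_derive_RInt (V := R_NormedModule) (fun x => f x y) _ a z); auto.
    exists (mkposreal 1 Rlt_0_1). intros w _. apply RI_is; auto. }
  assert (DG : forall z, is_derive (fun z => RInt (fun y => RInt (fun x => f x y) a z) c d) z
                          (RInt (fun y => f z y) c d)).
  { intros z.
    replace (RInt (fun y => f z y) c d) with
      (RInt (fun t => Derive (fun u => RInt (fun x => f x t) a u) z) c d).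
    2:{ apply RInt_ext. intros x _. apply is_derive_unique, Dx. }
    apply (is_derive_RInt_param (fun z y => RInt (fun x => f x y) a z)).
    - exists (mkposreal 1 Rlt_0_1). intros w _ t _. eexists; apply Dx.
    - intros t _. apply continuity_2d_pt_ext with (f := f); auto.
      intros u v. symmetry. apply is_derive_unique, Dx.
    - exists (mkposreal 1 Rlt_0_1). intros w _.
      apply (ex_RInt_continuous (V := R_CompleteNormedModule)). intros y _.
      (* The derivative is two-sided, so [w] may fall to the left of [a], where the bounds have to
         be swapped. *)
      destruct (Rle_dec a w).
      + apply RInt_param_continuous; auto.
      + apply continuous_ext with (f := fun y => - RInt (fun x => f x y) w a).
        { intros v. apply (opp_RInt_swap (V := R_CompleteNormedModule)). exists (RInt (fun x => f x v) w a).
          apply RI_is; auto. }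
        apply (continuous_opp (V := R_NormedModule)). apply RInt_param_continuous; auto. lra. }
  assert (E := is_RInt_derive (V := R_CompleteNormedModule) _ _ a b (fun x _ => DG x)
                 (fun x _ => RInt_param_continuous f' c d Hf' Hcd x)).
  apply is_RInt_unique in E. unfold f' in E. rewrite E.
  replace (RInt (fun y => RInt (fun x => f x y) a a) c d) with 0.
  - unfold minus, plus, opp; simpl.
    symmetry. exact (Rminus_0_r _).
  - symmetry. rewrite (RInt_ext _ (fun _ => 0)).
    + rewrite RInt_const. unfold scal; simpl; unfold mult; simpl; ring.
    + intros x _. apply (RInt_point (V := R_CompleteNormedModule)).
Qed.

Lemma CI_fst g a b : ccont g -> fst (CI g a b) = RInt (fun x => fst (g x)) a b.
Proof. intros H. symmetry. apply is_RInt_unique. apply is_RInt_C_fst, CI_is, H. Qed.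

Lemma CI_snd g a b : ccont g -> snd (CI g a b) = RInt (fun x => snd (g x)) a b.
Proof. intros H. symmetry. apply is_RInt_unique. apply is_RInt_C_snd, CI_is, H. Qed.

(** Stated on real and imaginary parts, the form in which [Fubini_rect] applies to each of them. *)
Definition ccont2 (f : R -> R -> C) : Prop := forall x y,
  continuity_2d_pt (fun x y => fst (f x y)) x y /\ continuity_2d_pt (fun x y => snd (f x y)) x y.

Lemma ccont2_1 f y : ccont2 f -> ccont (fun x => f x y).
Proof.
  intros H. apply ccont_ext with (f := fun x => (fst (f x y), snd (f x y))).
  { intros x; destruct (f x y); reflexivity. }
  apply ccont_pair; intros x; [apply (continuity_2d_slice1 (fun x y => fst (f x y)))
    | apply (continuity_2d_slice1 (fun x y => snd (f x y)))]; apply H.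
Qed.

Lemma ccont2_2 f x : ccont2 f -> ccont (fun y => f x y).
Proof.
  intros H. apply ccont_ext with (f := fun y => (fst (f x y), snd (f x y))).
  { intros y; destruct (f x y); reflexivity. }
  apply ccont_pair; intros y; [apply (continuity_2d_slice2 (fun x y => fst (f x y)))
    | apply (continuity_2d_slice2 (fun x y => snd (f x y)))]; apply H.
Qed.

Lemma ccont2_swap f : ccont2 f -> ccont2 (fun y x => f x y).
Proof.
  intros H x y. destruct (H y x) as [H1 H2].
  split; intros eps; [destruct (H1 eps) as [e He] | destruct (H2 eps) as [e He]];
  exists e; intros u v Hu Hv; apply He; auto.
Qed.

Lemma CI_param_ccont f a b : ccont2 f -> a <= b -> ccont (fun y => CI (fun x => f x y) a b).
Proof.
  intros H Hab.
  apply ccont_ext with (f := fun y => (RInt (fun x => fst (f x y)) a b, RInt (fun x => snd (f x y)) a b)).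
  { intros y. apply Ceq; simpl; symmetry; [apply CI_fst | apply CI_snd]; apply ccont2_1; auto. }
  apply ccont_pair; intros y.
  - apply (RInt_param_continuous (fun x y => fst (f x y))); auto. intros; apply H.
  - apply (RInt_param_continuous (fun x y => snd (f x y))); auto. intros; apply H.
Qed.

Lemma CI_Fubini f a b c d : ccont2 f -> a <= b -> c <= d ->
  CI (fun y => CI (fun x => f x y) a b) c d = CI (fun x => CI (fun y => f x y) c d) a b.
Proof.
  intros H Hab Hcd.
  apply Ceq.
  - rewrite !CI_fst.
    + rewrite (RInt_ext _ (fun y => RInt (fun x => fst (f x y)) a b)).
      2:{ intros. apply CI_fst. apply ccont2_1; auto. }
      rewrite (RInt_ext (fun x => fst (CI _ _ _)) (fun x => RInt (fun y => fst (f x y)) c d)).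
      2:{ intros. apply CI_fst. apply ccont2_2; auto. }
      apply Fubini_rect; auto. apply H.
    + apply (CI_param_ccont (fun y x => f x y)); auto. apply ccont2_swap; auto.
    + apply CI_param_ccont; auto.
  - rewrite !CI_snd.
    + rewrite (RInt_ext _ (fun y => RInt (fun x => snd (f x y)) a b)).
      2:{ intros. apply CI_snd. apply ccont2_1; auto. }
      rewrite (RInt_ext (fun x => snd (CI _ _ _)) (fun x => RInt (fun y => snd (f x y)) c d)).
      2:{ intros. apply CI_snd. apply ccont2_2; auto. }
      apply Fubini_rect; auto. apply H.
    + apply (CI_param_ccont (fun y x => f x y)); auto. apply ccont2_swap; auto.
    + apply CI_param_ccont; auto.
Qed.

Lemma continuous_2d_fst (f : R -> R) : (forall x, continuous f x) ->
  forall x y, continuity_2d_pt (fun x _ => f x) x y.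
Proof.
  intros H x y. apply (continuity_1d_2d_pt_comp f (fun x _ => x)).
  apply continuity_pt_filterlim, H. apply continuity_2d_pt_id1.
Qed.

Lemma ccont2_mult f g : ccont2 f -> ccont2 g -> ccont2 (fun x y => Cmult (f x y) (g x y)).
Proof.
  intros Hf Hg x y. destruct (Hf x y), (Hg x y). split; simpl.
  - apply continuity_2d_pt_minus; apply continuity_2d_pt_mult; auto.
  - apply continuity_2d_pt_plus; apply continuity_2d_pt_mult; auto.
Qed.

Lemma ccont2_fst g : ccont g -> ccont2 (fun x _ => g x).
Proof.
  intros H x y. split.
  - apply (continuous_2d_fst (fun x => fst (g x))). apply ccont_fst; auto.
  - apply (continuous_2d_fst (fun x => snd (g x))). apply ccont_snd; auto.
Qed.

Lemma ccont2_snd g : ccont g -> ccont2 (fun _ y => g y).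
Proof. intros H. apply (ccont2_swap (fun x _ => g x)). apply ccont2_fst; auto. Qed.

(** The shift [m] is the frequency offset in the orthogonality relation; inversion takes [m = 0]. *)
Lemma ccont2_expi_bilin k m : ccont2 (fun x y => expi (k * ((x + m) * y))).
Proof.
  assert (P : forall x y, continuity_2d_pt (fun x y => k * ((x + m) * y)) x y).
  { intros x y. apply continuity_2d_pt_mult. apply continuity_2d_pt_const.
    apply continuity_2d_pt_mult. apply continuity_2d_pt_plus. apply continuity_2d_pt_id1. apply continuity_2d_pt_const.
    apply continuity_2d_pt_id2. }
  intros x y; split; simpl.
  - apply (continuity_1d_2d_pt_comp cos); auto. apply continuity_cos.
  - apply (continuity_1d_2d_pt_comp sin); auto. apply continuity_sin.
Qed.

(** * The Fourier transform of an integrable positive function *)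

Definition mass (phi : R -> R) : R :=
  @RInt_gen R_CompleteNormedModule phi (Rbar_locally m_infty) (Rbar_locally p_infty).

Lemma phi_cont phi : phi_hyp phi -> forall x, continuous phi x.
Proof.
  intros [H _] x. apply (ex_derive_continuous (V := R_NormedModule)). exact (H 1%nat x).
Qed.

Lemma phi_pos phi : phi_hyp phi -> forall x, 0 < phi x.
Proof. intros H; apply H. Qed.

Lemma mass_approx phi : phi_hyp phi -> forall eps, 0 < eps ->
  exists A, 0 < A /\ forall a b, a <= - A -> A <= b -> Rabs (RInt phi a b - mass phi) <= eps.
Proof.
  intros H eps He.
  assert (HG : is_RInt_gen phi (Rbar_locally m_infty) (Rbar_locally p_infty) (mass phi)).
  { apply (RInt_gen_correct (V := R_CompleteNormedModule)). apply H. }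
  specialize (HG (fun y => @ball R_UniformSpace (mass phi) (mkposreal _ He) y)).
  destruct HG as [Q1 Q2 [A1 H1] [A2 H2] HQ].
  { exists (mkposreal _ He). auto. }
  exists (Rmax 1 (Rmax (1 - A1) (1 + A2))). split.
  { generalize (Rmax_l 1 (Rmax (1 - A1) (1 + A2))); lra. }
  intros a b Ha Hb.
  generalize (Rmax_r 1 (Rmax (1 - A1) (1 + A2))) (Rmax_l (1 - A1) (1 + A2)) (Rmax_r (1 - A1) (1 + A2)). intros M0 M1 M2.
  destruct (HQ a b) as [y [Hy1 Hy2]].
  - apply H1. lra.
  - apply H2. lra.
  - simpl in Hy1. rewrite (is_RInt_unique _ _ _ _ Hy1).
    left. exact Hy2.
Qed.

Lemma RInt_phi_Chasles phi a b c : phi_hyp phi -> RInt phi a b + RInt phi b c = RInt phi a c.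
Proof.
  intros H. apply (RInt_Chasles (V := R_CompleteNormedModule)); eexists; apply RI_is, phi_cont, H.
Qed.

Lemma RInt_phi_ge_0 phi a b : phi_hyp phi -> a <= b -> 0 <= RInt phi a b.
Proof.
  intros H Hab. apply RInt_ge_0; auto.
  - eexists; apply RI_is, phi_cont, H.
  - intros. left. apply phi_pos, H.
Qed.

Lemma RInt_phi_le_mass phi a b : phi_hyp phi -> a <= b -> RInt phi a b <= mass phi.
Proof.
  intros H Hab. apply le_epsilon. intros eps He.
  destruct (mass_approx phi H eps He) as [A [HA0 HA]].
  specialize (HA (Rmin a (- A)) (Rmax b A) (Rmin_r _ _) (Rmax_r _ _)).
  rewrite <- (RInt_phi_Chasles phi (Rmin a (- A)) a (Rmax b A) H), <- (RInt_phi_Chasles phi a b (Rmax b A) H) in HA.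
  generalize (RInt_phi_ge_0 phi _ _ H (Rmin_l a (- A))) (RInt_phi_ge_0 phi _ _ H (Rmax_l b A)).
  intros. generalize (Rle_abs (RInt phi (Rmin a (- A)) a + (RInt phi a b + RInt phi b (Rmax b A)) - mass phi)). lra.
Qed.

Lemma mass_pos phi : phi_hyp phi -> 0 < mass phi.
Proof.
  intros H. apply Rlt_le_trans with (RInt phi 0 1).
  - apply RInt_gt_0; try lra.
    + intros; apply phi_pos, H.
    + intros; apply phi_cont, H.
  - apply RInt_phi_le_mass; auto; lra.
Qed.

(** The two intervals differ by end pieces, on which [u] integrates to at most [M] times the mass of
    [phi] there. This replaces dominated convergence in what follows. *)
Lemma dom_CI_diff phi u M a b a' b' : phi_hyp phi -> ccont u ->
  (forall x, Cmod (u x) <= M * phi x) -> a' <= a -> a <= b -> b <= b' ->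
  Cmod (Cminus (CI u a b) (CI u a' b')) <= M * (mass phi - RInt phi a b).
Proof.
  intros H Hu HM H1 H2 H3.
  assert (HM0 : 0 <= M).
  { specialize (HM 0). generalize (Cmod_ge_0 (u 0)) (phi_pos phi H 0). intros. nra. }
  assert (P : forall c d, c <= d -> Cmod (CI u c d) <= M * RInt phi c d).
  { intros c d Hcd.
    replace (M * RInt phi c d) with (RInt (fun x => M * phi x) c d).
    - apply CI_le; auto. intros x. apply (continuous_scal_r (V := R_NormedModule)). apply phi_cont, H.
    - apply (RInt_scal (V := R_CompleteNormedModule)). eexists; apply RI_is, phi_cont, H. }
  rewrite <- (CI_Chasles u a' a b'), <- (CI_Chasles u a b b') by auto.
  match goal with |- Cmod ?z <= _ => replace z with (Copp (Cplus (CI u a' a) (CI u b b'))) by ring end.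
  rewrite Cmod_opp. eapply Rle_trans. apply Cmod_triangle.
  generalize (P _ _ H1) (P _ _ H3). intros.
  assert (RInt phi a' a + RInt phi a b + RInt phi b b' <= mass phi).
  { rewrite !RInt_phi_Chasles by auto. apply RInt_phi_le_mass; auto. lra. }
  nra.
Qed.

Lemma dom_tail phi u M I a b : phi_hyp phi -> ccont u ->
  (forall x, Cmod (u x) <= M * phi x) -> lineint u I -> a <= b ->
  Cmod (Cminus (CI u a b) I) <= M * (mass phi - RInt phi a b).
Proof.
  intros H Hu HM HI Hab. apply le_epsilon. intros eps He.
  destruct (lineint_elim u I HI eps He) as [A [HA0 HA]].
  specialize (HA (Rmin a (- A)) (Rmax b A) (Rmin_r _ _) (Rmax_r _ _)).
  generalize (dom_CI_diff phi u M a b (Rmin a (- A)) (Rmax b A) H Hu HM (Rmin_l _ _) Hab (Rmax_l _ _)). intros.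
  set (z := CI u (Rmin a (- A)) (Rmax b A)) in *.
  replace (Cminus (CI u a b) I) with (Cplus (Cminus (CI u a b) z) (Cminus z I)) by ring.
  eapply Rle_trans. apply Cmod_triangle. lra.
Qed.

(** Cauchy criterion: any two long truncations are compared with the one over [[-A, A]], at a cost
    below [eps / 2] each. *)
Lemma dom_exists phi u M : phi_hyp phi -> ccont u ->
  (forall x, Cmod (u x) <= M * phi x) -> exists I, lineint u I.
Proof.
  intros H Hu HM.
  assert (HM0 : 0 <= M).
  { specialize (HM 0). generalize (Cmod_ge_0 (u 0)) (phi_pos phi H 0). intros. nra. }
  destruct (proj1 (filterlim_locally_cauchy (U := CV)
    (F := filter_prod (Rbar_locally m_infty) (Rbar_locally p_infty))
    (fun ab : R * R => CI u (fst ab) (snd ab)))) as [I HI].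
  - intros eps.
    assert (He : 0 < eps / (4 * (1 + M))). { apply Rdiv_lt_0_compat. apply cond_pos. lra. }
    destruct (mass_approx phi H _ He) as [A [HA0 HA]].
    exists (fun ab => fst ab < - A /\ A < snd ab). split.
    + apply Filter_prod with (fun a => a < - A) (fun b => A < b).
      * exists (- A); auto.
      * exists A; auto.
      * auto.
    + intros [a b] [a' b'] [Ha Hb] [Ha' Hb']. simpl in *. apply ball_C_Cmod.
      assert (P : forall a b, a < - A -> A < b -> Cmod (Cminus (CI u (-A) A) (CI u a b)) <= M * (eps / (4 * (1 + M)))).
      { intros c d Hc Hd. eapply Rle_trans. apply (dom_CI_diff phi u M); auto; lra.
        apply Rmult_le_compat_l; auto. specialize (HA (-A) A (Rle_refl _) (Rle_refl _)).
        apply Rabs_le_between in HA. lra. }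
      replace (Cminus (CI u a' b') (CI u a b)) with
        (Cplus (Cminus (CI u (-A) A) (CI u a b)) (Copp (Cminus (CI u (-A) A) (CI u a' b')))) by ring.
      eapply Rle_lt_trans. apply Cmod_triangle. rewrite Cmod_opp.
      generalize (P a b Ha Hb) (P a' b' Ha' Hb'). intros.
      assert (M * (eps / (4 * (1 + M))) < eps / 2).
      { generalize (cond_pos eps); intros.
        apply Rmult_lt_reg_r with (4 * (1 + M)). lra.
        replace (M * (eps / (4 * (1 + M))) * (4 * (1 + M))) with (M * eps) by (field; lra). nra. }
      lra.
  - exists I. intros P HP. specialize (HI P HP). unfold filtermap in HI.
    revert HI. apply (filter_imp (F := filter_prod (Rbar_locally m_infty) (Rbar_locally p_infty))).
    intros [a b] Hab. exists (CI u a b). split; auto. apply CI_is; auto.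
Qed.

(** The sign is opposite to that of the Fourier kernel, which is why the integral below is the
    transform at [- k]. *)
Definition wave (phi : R -> R) (k : R) (s : R) : C := Cmult (RtoC (phi s)) (expi (2 * PI * (s * k))).

Lemma wave_ccont phi k : phi_hyp phi -> ccont (wave phi k).
Proof.
  intros H. apply ccont_mult.
  - apply ccont_RtoC, phi_cont, H.
  - apply ccont_expi. intros x. apply (ex_derive_continuous (V := R_NormedModule)). auto_derive; auto.
Qed.

Lemma wave_mod phi k s : phi_hyp phi -> Cmod (wave phi k s) <= 1 * phi s.
Proof.
  intros H. unfold wave. rewrite Cmod_mult, Cmod_expi, Cmod_R, Rabs_right. lra.
  generalize (phi_pos phi H s); lra.
Qed.

Lemma hat_lineint phi k : phi_hyp phi -> lineint (wave phi k) (fourier1 phi (- k)).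
Proof.
  intros H. destruct (dom_exists phi _ 1 H (wave_ccont phi k H) (fun s => wave_mod phi k s H)) as [I HI].
  replace (fourier1 phi (- k)) with I; auto.
  symmetry. apply lineint_unique. apply lineint_ext with (f := wave phi k); auto.
  intros s. unfold wave. simpl. unfold upd; simpl. do 2 f_equal. ring.
Qed.

(** The bound does not depend on [k]. This uniformity gives the continuity of the transform and lets
    it be truncated under an outer integral. *)
Lemma hat_tail phi k a b : phi_hyp phi -> a <= b ->
  Cmod (Cminus (CI (wave phi k) a b) (fourier1 phi (- k))) <= mass phi - RInt phi a b.
Proof.
  intros H Hab. rewrite <- (Rmult_1_l (mass phi - _)).
  apply dom_tail; auto.
  - apply wave_ccont; auto.
  - intros; apply wave_mod; auto.
  - apply hat_lineint; auto.
Qed.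

Lemma hat_le_mass phi k : phi_hyp phi -> Cmod (fourier1 phi k) <= mass phi.
Proof.
  intros H. generalize (hat_tail phi (- k) 0 0 H (Rle_refl 0)). rewrite Ropp_involutive.
  rewrite RInt_point. replace (CI (wave phi (- k)) 0 0) with (RtoC 0).
  - replace (Cminus 0 (fourier1 phi k)) with (Copp (fourier1 phi k)) by ring.
    rewrite Cmod_opp. unfold zero; simpl. lra.
  - symmetry. apply (RInt_point (V := CV)).
Qed.

Lemma CI_lip_expi (g : R -> C) (th1 th2 : R -> R) a b e G : a <= b -> ccont g ->
  (forall x, continuous th1 x) -> (forall x, continuous th2 x) ->
  (forall x, a <= x <= b -> Cmod (g x) <= G) ->
  (forall x, a <= x <= b -> Rabs (th1 x - th2 x) <= e) ->
  Cmod (Cminus (CI (fun x => Cmult (g x) (expi (th1 x))) a b) (CI (fun x => Cmult (g x) (expi (th2 x))) a b))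
   <= (b - a) * (G * e).
Proof.
  intros Hab Hg H1 H2 HG He.
  rewrite <- CI_minus by (apply ccont_mult; auto; apply ccont_expi; auto).
  apply CI_le_const; auto.
  - apply ccont_ext with (f := fun x => Cplus (Cmult (g x) (expi (th1 x)))
       (Cmult (Copp (RtoC 1)) (Cmult (g x) (expi (th2 x))))).
    + intros; ring.
    + apply ccont_plus; repeat apply ccont_mult; auto using ccont_expi, ccont_const.
  - intros x Hx.
    replace (Cminus (Cmult (g x) (expi (th1 x))) (Cmult (g x) (expi (th2 x)))) with
      (Cmult (g x) (Cminus (expi (th1 x)) (expi (th2 x)))) by ring.
    rewrite Cmod_mult. apply Rmult_le_compat; auto using Cmod_ge_0.
    eapply Rle_trans. apply expi_lip. auto.
Qed.

Lemma ccont_intro (g : R -> C) :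
  (forall x eps, 0 < eps -> exists d, 0 < d /\ forall y, Rabs (y - x) < d -> Cmod (Cminus (g y) (g x)) < eps) ->
  ccont g.
Proof.
  intros H x P [eps HP]. destruct (H x eps (cond_pos eps)) as [d [Hd Hx]].
  exists (mkposreal d Hd). intros y Hy. apply HP, ball_C_Cmod, Hx, Hy.
Qed.

(** Two tails cost [eps / 4] each by the uniform bound; on [[-A, A]] the truncated transform is
    Lipschitz in the frequency with constant [2 A * (G * (2 PI A))], where [G] is the maximum of
    [phi] there. *)
Lemma hat_ccont phi : phi_hyp phi -> ccont (fourier1 phi).
Proof.
  intros H. apply ccont_intro. intros x eps He.
  destruct (mass_approx phi H (eps / 4)) as [A [HA0 HA]]. lra.
  specialize (HA (-A) A (Rle_refl _) (Rle_refl _)). apply Rabs_le_between in HA.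
  destruct (continuity_ab_maj phi (-A) A) as [mx [Hmx _]]. lra.
  { intros c _. apply continuity_pt_filterlim, (phi_cont phi H). }
  set (G := phi mx) in *. assert (HG : 0 < G) by apply (phi_pos phi H).
  assert (HK : 0 < 2 * A * (G * (2 * PI * A))).
  { generalize PI_RGT_0. intros.
    apply Rmult_lt_0_compat; [lra|]. apply Rmult_lt_0_compat; [lra|]. apply Rmult_lt_0_compat; lra. }
  exists (eps / 4 / (2 * A * (G * (2 * PI * A)))). split. { apply Rdiv_lt_0_compat; lra. }
  intros y Hy.
  generalize (hat_tail phi (- x) (-A) A H) (hat_tail phi (- y) (-A) A H). rewrite !Ropp_involutive. intros T1 T2.
  assert (T : Cmod (Cminus (CI (wave phi (- x)) (-A) A) (CI (wave phi (- y)) (-A) A)) <= eps / 4).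
  { eapply Rle_trans.
    - apply (CI_lip_expi (fun s => RtoC (phi s)) (fun s => 2 * PI * (s * - x)) (fun s => 2 * PI * (s * - y)) (-A) A (2 * PI * A * Rabs (y - x)) G).
      + lra.
      + apply ccont_RtoC, phi_cont, H.
      + intros z. apply (ex_derive_continuous (V := R_NormedModule)). auto_derive; auto.
      + intros z. apply (ex_derive_continuous (V := R_NormedModule)). auto_derive; auto.
      + intros z Hz. rewrite Cmod_R, Rabs_right. auto. generalize (phi_pos phi H z); lra.
      + intros z Hz. replace (2 * PI * (z * - x) - 2 * PI * (z * - y)) with (2 * PI * z * (y - x)) by ring.
        rewrite Rabs_mult. apply Rmult_le_compat_r. apply Rabs_pos.
        rewrite Rabs_mult, Rabs_right. 2: generalize PI_RGT_0; lra.
        apply Rmult_le_compat_l. generalize PI_RGT_0; lra. apply Rabs_le; lra.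
    - apply Rmult_lt_compat_r with (r := 2 * A * (G * (2 * PI * A))) in Hy; auto.
      replace (eps / 4 / (2 * A * (G * (2 * PI * A))) * (2 * A * (G * (2 * PI * A)))) with (eps / 4) in Hy.
      2:{ field. generalize PI_RGT_0; intros; repeat split; lra. }
      lra. }
  set (zx := CI (wave phi (- x)) (-A) A) in *. set (zy := CI (wave phi (- y)) (-A) A) in *.
  replace (Cminus (fourier1 phi y) (fourier1 phi x)) with
    (Cplus (Cplus (Copp (Cminus zy (fourier1 phi y))) (Cminus zx (fourier1 phi x))) (Copp (Cminus zx zy))) by ring.
  eapply Rle_lt_trans. apply Cmod_triangle.
  eapply Rle_lt_trans. apply Rplus_le_compat_r, Cmod_triangle.
  rewrite !Cmod_opp. assert (-A <= A) by lra. specialize (T1 H0). specialize (T2 H0). lra.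
Qed.

Lemma hat_supp phi k : phi_hyp phi -> 1 <= Rabs k -> fourier1 phi k = RtoC 0.
Proof. intros (_ & _ & _ & [a [Ha H]] & _) Hk. apply H. lra. Qed.

(** * Poisson kernel and Fourier inversion *)

Ltac cont_auto := intros; apply (ex_derive_continuous (V := R_NormedModule)); auto_derive; auto.

(** The pair is [1 / (s + i v)], so this is the antiderivative of [exp ((s + i v) y)]. *)
Definition expC_prim (s v : R) (y : R) : C :=
  Cmult (RtoC (exp (s * y))) (Cmult (expi (v * y)) (s / (s ^ 2 + v ^ 2), - v / (s ^ 2 + v ^ 2))).

Lemma expC_prim_is_RInt s v a b : s <> 0 ->
  @is_RInt CV (fun y => Cmult (RtoC (exp (s * y))) (expi (v * y))) a b (Cminus (expC_prim s v b) (expC_prim s v a)).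
Proof.
  intros Hs.
  assert (HN : s ^ 2 + v ^ 2 <> 0) by nra.
  apply is_RInt_C.
  - apply (is_RInt_derive (V := R_CompleteNormedModule) (fun y => fst (expC_prim s v y))).
    + intros y _. unfold expC_prim; simpl. auto_derive; auto. field. intros Q; apply HN; rewrite <- Q; ring.
    + simpl. cont_auto.
  - apply (is_RInt_derive (V := R_CompleteNormedModule) (fun y => snd (expC_prim s v y))).
    + intros y _. unfold expC_prim; simpl. auto_derive; auto. field. intros Q; apply HN; rewrite <- Q; ring.
    + simpl. cont_auto.
Qed.

Lemma expC_prim_mod s v y : s <> 0 -> Cmod (expC_prim s v y) <= exp (s * y) / Rabs s.
Proof.
  intros Hs. unfold expC_prim. rewrite !Cmod_mult, Cmod_expi, Cmod_R, Rabs_right.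
  2:{ left; apply exp_pos. }
  unfold Rdiv. apply Rmult_le_compat_l. left; apply exp_pos. rewrite Rmult_1_l.
  assert (Ha : 0 < Rabs s) by (apply Rabs_pos_lt; auto).
  assert (HN : 0 < s ^ 2 + v ^ 2) by nra.
  rewrite <- (sqrt_Rsqr (/ Rabs s)).
  2:{ left; apply Rinv_0_lt_compat; auto. }
  apply sqrt_le_1_alt. unfold fst, snd.
  replace ((s * / (s ^ 2 + v ^ 2)) ^ 2 + (- v * / (s ^ 2 + v ^ 2)) ^ 2) with (/ (s ^ 2 + v ^ 2)).
  2:{ field. lra. }
  unfold Rsqr. rewrite <- Rinv_mult. rewrite <- Rabs_mult, Rabs_right by nra.
  apply Rinv_le_contravar; nra.
Qed.

Definition poisson (eps u : R) : R := 2 * eps / (eps ^ 2 + (2 * PI * u) ^ 2).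

Definition damp (eps y : R) : R := exp (- eps * Rabs y).

Lemma damp_cont eps y : continuous (damp eps) y.
Proof.
  unfold damp. apply (continuous_comp (fun y => - eps * Rabs y) exp).
  - apply (continuous_comp Rabs (fun y => - eps * y)).
    + apply continuity_pt_filterlim, Rcontinuity_abs.
    + cont_auto.
  - cont_auto.
Qed.

Lemma damp_bound eps y : 0 <= eps -> Rabs (damp eps y) <= 1.
Proof.
  intros He. unfold damp. rewrite Rabs_right by (left; apply exp_pos).
  rewrite <- exp_0. generalize (Rabs_pos y); intros.
  destruct (Req_dec (- eps * Rabs y) 0) as [->|Hn]. lra.
  left. apply exp_increasing. nra.
Qed.

Lemma damp_near_1 eps y : 0 <= eps -> Rabs y <= 1 -> Rabs (damp eps y - 1) <= eps.
Proof.
  intros He Hy. generalize (damp_bound eps y He). unfold damp. rewrite Rabs_right by (left; apply exp_pos). intros.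
  rewrite Rabs_left1 by lra. generalize (exp_ineq1_le (- eps * Rabs y)) (Rabs_pos y). nra.
Qed.

(** Each half of the interval has an explicit antiderivative. The boundary terms at 0 add up to
    [1 / (eps + i v) + 1 / (eps - i v)] with [v = 2 PI u], which is the kernel; those at [- B] and
    [B] are the error. *)
Lemma poisson_approx eps B u : 0 < eps -> 0 < B ->
  Cmod (Cminus (CI (fun y => Cmult (RtoC (damp eps y)) (expi (2 * PI * u * y))) (- B) B) (RtoC (poisson eps u)))
    <= 2 * exp (- eps * B) / eps.
Proof.
  intros He HB.
  rewrite <- (CI_Chasles _ (- B) 0 B).
  2:{ apply ccont_mult. apply ccont_RtoC. intros; apply damp_cont. apply ccont_expi. cont_auto. }
  rewrite (CI_ext _ (fun y => Cmult (RtoC (exp (eps * y))) (expi (2 * PI * u * y))) (- B) 0).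
  2:{ intros x. rewrite Rmin_left, Rmax_right by lra. intros Hx. unfold damp.
      rewrite Rabs_left by lra. do 3 f_equal. ring. }
  rewrite (CI_ext _ (fun y => Cmult (RtoC (exp (- eps * y))) (expi (2 * PI * u * y))) 0 B).
  2:{ intros x. rewrite Rmin_left, Rmax_right by lra. intros Hx. unfold damp.
      rewrite Rabs_right by lra. reflexivity. }
  rewrite (CI_unique _ _ _ _ (expC_prim_is_RInt eps (2 * PI * u) (- B) 0 (Rgt_not_eq _ _ He))).
  assert (He' : - eps <> 0) by lra.
  rewrite (CI_unique _ _ _ _ (expC_prim_is_RInt (- eps) (2 * PI * u) 0 B He')).
  replace (RtoC (poisson eps u)) with (Cminus (expC_prim eps (2 * PI * u) 0) (expC_prim (- eps) (2 * PI * u) 0)).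
  2:{ unfold expC_prim, poisson. rewrite !Rmult_0_r, exp_0, expi_0.
      assert (eps ^ 2 + (2 * PI * u) ^ 2 <> 0) by nra.
      apply Ceq; simpl; field; nra. }
  match goal with |- Cmod ?z <= _ => replace z with
    (Cplus (Copp (expC_prim eps (2 * PI * u) (- B))) (expC_prim (- eps) (2 * PI * u) B)) by ring end.
  eapply Rle_trans. apply Cmod_triangle. rewrite Cmod_opp.
  generalize (expC_prim_mod eps (2 * PI * u) (- B) (Rgt_not_eq _ _ He)) (expC_prim_mod (- eps) (2 * PI * u) B He').
  rewrite Rabs_Ropp, (Rabs_right eps) by lra. replace (eps * - B) with (- eps * B) by ring.
  intros. replace (2 * exp (- eps * B) / eps) with (exp (- eps * B) / eps + exp (- eps * B) / eps) by (field; lra). lra.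
Qed.

Lemma poisson_pos eps u : 0 < eps -> 0 < poisson eps u.
Proof. intros. unfold poisson. apply Rdiv_lt_0_compat. lra. nra. Qed.

Lemma poisson_cont eps x : 0 < eps -> forall y, continuous (fun y => poisson eps (x - y)) y.
Proof.
  intros He y. apply (ex_derive_continuous (V := R_NormedModule)). unfold poisson.
  auto_derive. assert (0 < eps * eps) by nra.
  assert (0 <= (2 * PI * (x - y)) * (2 * PI * (x - y))) by apply Rle_0_sqr.
  apply Rgt_not_eq. unfold Rgt. unfold Rminus in *. lra.
Qed.

Lemma poisson_RInt eps x r : 0 < eps ->
  is_RInt (fun y => poisson eps (x - y)) (x - r) (x + r) (2 / PI * atan (2 * PI * r / eps)).
Proof.
  intros He. assert (HPI := PI_RGT_0).
  replace (2 / PI * atan (2 * PI * r / eps)) with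
    (- / PI * atan (2 * PI * (x - (x + r)) / eps) - - / PI * atan (2 * PI * (x - (x - r)) / eps)).
  2:{ replace (2 * PI * (x - (x + r)) / eps) with (- (2 * PI * r / eps)) by (field; lra).
      replace (2 * PI * (x - (x - r)) / eps) with (2 * PI * r / eps) by (field; lra).
      rewrite atan_opp. field; lra. }
  apply (is_RInt_derive (V := R_CompleteNormedModule) (fun y => - / PI * atan (2 * PI * (x - y) / eps))).
  - intros y _. unfold poisson. auto_derive; auto. field.
    generalize (pow2_ge_0 (2 * PI * (x - y))) (pow_lt eps 2 He). intros. repeat split; lra.
  - intros; apply poisson_cont; auto.
Qed.

Lemma RInt_le_cont (f g : R -> R) a b : a <= b -> (forall x, continuous f x) -> (forall x, continuous g x) ->
  (forall x, a <= x <= b -> f x <= g x) -> RInt f a b <= RInt g a b.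
Proof.
  intros. apply RInt_le; auto; try (eexists; apply RI_is; auto). intros; apply H2; lra.
Qed.

Lemma RInt_scal_cont (f : R -> R) k a b : (forall x, continuous f x) ->
  RInt (fun x => k * f x) a b = k * RInt f a b.
Proof. intros. apply (RInt_scal (V := R_CompleteNormedModule)). eexists; apply RI_is; auto. Qed.

(** The left side is [atan (/ z)], and [atan] has slope at most 1. It measures the mass of the
    Poisson kernel outside a neighbourhood of its centre. *)
Lemma atan_compl z : 0 < z -> PI / 2 - atan z <= / z.
Proof.
  intros Hz. assert (E : atan (/ z) = PI / 2 - atan z) by (apply atan_inv; auto).
  rewrite <- E. destruct (Rle_dec (atan (/ z)) (/ z)); auto. exfalso.
  assert (Hi := Rinv_0_lt_compat z Hz).
  destruct (MVT_cor2 atan (fun c => / (1 + c ^ 2)) 0 (/ z) Hi) as [c [Hc1 Hc2]].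
  - intros c _. apply is_derive_Reals. auto_derive; auto. field. nra.
  - rewrite atan_0 in Hc1. assert (/ (1 + c ^ 2) <= 1). { rewrite <- Rinv_1. apply Rinv_le_contravar; nra. } nra.
Qed.

(** No bound on [phi] is available yet. Within distance [r] of [x] continuity is used; farther away
    the kernel is at most [eps / r ^ 2], and integrability of [phi] suffices. *)
Lemma poisson_identity phi x gam : phi_hyp phi -> 0 < gam ->
  exists e0, 0 < e0 /\ forall eps, 0 < eps -> eps <= e0 -> exists A0, forall A, A0 <= A ->
    Rabs (RInt (fun y => phi y * poisson eps (x - y)) (- A) A - phi x) <= gam.
Proof.
  intros H Hg. assert (HPI := PI_RGT_0). assert (PI > 1) by (generalize PI2_1; lra).
  assert (Hm := mass_pos phi H). assert (Hp := phi_pos phi H x).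
  assert (Hc : continuity_pt phi x) by (apply continuity_pt_filterlim, phi_cont, H).
  assert (Hg4 : 0 < gam / 4) by lra.
  destruct (proj1 (continuity_pt_locally phi x) Hc (mkposreal _ Hg4)) as [r0 Hr0]. simpl in Hr0.
  assert (Hr00 := cond_pos r0).
  set (r := r0 / 2). assert (Hr : 0 < r) by (unfold r; lra).
  assert (Hnear : forall y, x - r <= y <= x + r -> phi x - gam / 4 <= phi y <= phi x + gam / 4).
  { intros y Hy. specialize (Hr0 y). assert (Rabs (phi y - phi x) < gam / 4).
    { apply Hr0. change (Rabs (y - x) < r0). apply Rabs_def1; unfold r in *; lra. }
    apply Rabs_def2 in H1. lra. }
  (* The first term keeps the kernel mass missing from the window, times [phi x], below [gam / 4];
     the second does the same for each of the two far pieces. The oscillation of [phi] near [x]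
     takes the last quarter. *)
  exists (Rmin (gam * r / (4 * phi x)) (gam * r ^ 2 / (4 * mass phi))). split.
  { apply Rmin_glb_lt; apply Rdiv_lt_0_compat; try lra; apply Rmult_lt_0_compat; auto; apply pow_lt; auto. }
  intros eps He He0.
  assert (E1 : phi x * (eps / r) <= gam / 4).
  { apply Rle_trans with (phi x * (gam * r / (4 * phi x) / r)).
    - apply Rmult_le_compat_l. lra. apply Rmult_le_compat_r. left; apply Rinv_0_lt_compat; lra.
      eapply Rle_trans. exact He0. apply Rmin_l.
    - right; field; lra. }
  assert (E2 : mass phi * (eps / r ^ 2) <= gam / 4).
  { assert (0 < r ^ 2) by nra. apply Rle_trans with (mass phi * (gam * r ^ 2 / (4 * mass phi) / r ^ 2)).
    - apply Rmult_le_compat_l. lra. apply Rmult_le_compat_r. left; apply Rinv_0_lt_compat; lra.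
      eapply Rle_trans. exact He0. apply Rmin_r.
    - right; field; lra. }
  assert (Hpc : forall y, continuous phi y) by (apply phi_cont, H).
  set (F := fun y => phi y * poisson eps (x - y)).
  assert (HF : forall y, continuous F y).
  { intros y. apply (continuous_mult (K := R_AbsRing)). apply Hpc. apply poisson_cont; auto. }
  exists (Rabs x + r). intros A HA.
  assert (Hx1 := Rle_abs x). assert (Hx2 := Rle_abs (- x)). rewrite Rabs_Ropp in Hx2.
  assert (C1 : RInt F (- A) A = RInt F (- A) (x - r) + RInt F (x - r) (x + r) + RInt F (x + r) A).
  { rewrite <- (RInt_Chasles (V := R_CompleteNormedModule) F (- A) (x + r) A),
      <- (RInt_Chasles (V := R_CompleteNormedModule) F (- A) (x - r) (x + r));
      try (eexists; apply RI_is; auto). }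
  assert (Far : forall a b, a <= b -> (b <= x - r \/ x + r <= a) -> 0 <= RInt F a b <= mass phi * (eps / r ^ 2)).
  { intros a b Hab Hd. split.
    - apply RInt_ge_0; auto. eexists; apply RI_is; auto. intros y _. unfold F.
      generalize (phi_pos phi H y) (poisson_pos eps (x - y) He). nra.
    - apply Rle_trans with (RInt (fun y => (eps / r ^ 2) * phi y) a b).
      + apply RInt_le_cont; auto.
        * intros y. apply (continuous_scal_r (V := R_NormedModule)). apply Hpc.
        * intros y Hy. unfold F. rewrite Rmult_comm. apply Rmult_le_compat_r. left; apply phi_pos, H.
          unfold poisson. assert (0 < r ^ 2) by nra.
          assert (r ^ 2 <= (x - y) ^ 2). { destruct Hd; nra. }
          assert (r ^ 2 * 2 <= eps ^ 2 + (2 * PI * (x - y)) ^ 2).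
          { replace ((2 * PI * (x - y)) ^ 2) with (4 * (PI * PI) * (x - y) ^ 2) by ring.
            assert (1 < PI * PI) by nra. nra. }
          apply Rle_trans with (2 * eps / (r ^ 2 * 2)).
          { apply Rmult_le_compat_l. lra. apply Rinv_le_contravar; lra. }
          right; field; lra.
      + rewrite RInt_scal_cont by auto. rewrite Rmult_comm. apply Rmult_le_compat_r.
        * left. apply Rdiv_lt_0_compat; nra.
        * apply RInt_phi_le_mass; auto. }
  assert (F1 := Far (- A) (x - r)). assert (F2 := Far (x + r) A).
  set (m := 2 / PI * atan (2 * PI * r / eps)).
  assert (Hm0 : 0 < 2 * PI * r / eps). { apply Rdiv_lt_0_compat; try lra. apply Rmult_lt_0_compat; lra. }
  assert (Hm1 : 0 <= m <= 1 /\ 1 - m <= eps / r).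
  { unfold m. generalize (atan_bound (2 * PI * r / eps)) (atan_compl _ Hm0) (atan_increasing 0 _ Hm0).
    rewrite atan_0. set (at' := atan (2 * PI * r / eps)). intros Q1 Q2 Q3.
    assert (0 < 2 / PI) by (apply Rdiv_lt_0_compat; lra).
    assert (Q4 : 2 / PI * (PI / 2) = 1) by (field; lra).
    split; [split; nra|].
    rewrite <- Q4. replace (2 / PI * (PI / 2) - 2 / PI * at') with (2 / PI * (PI / 2 - at')) by ring.
    apply Rle_trans with (2 / PI * / (2 * PI * r / eps)). apply Rmult_le_compat_l; lra.
    replace (2 / PI * / (2 * PI * r / eps)) with (eps / r * / (PI * PI)) by (field; lra).
    rewrite <- (Rmult_1_r (eps / r)) at 2. apply Rmult_le_compat_l.
    left; apply Rdiv_lt_0_compat; lra. rewrite <- Rinv_1. apply Rinv_le_contravar; nra. }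
  assert (Mid : (phi x - gam / 4) * m <= RInt F (x - r) (x + r) <= (phi x + gam / 4) * m).
  { assert (Em : RInt (fun y => poisson eps (x - y)) (x - r) (x + r) = m).
    { apply is_RInt_unique, poisson_RInt; auto. }
    rewrite <- Em, <- !RInt_scal_cont by (apply poisson_cont; auto).
    split; apply RInt_le_cont; auto; try lra.
    1,3 : intros y; apply (continuous_scal_r (V := R_NormedModule)); apply poisson_cont; auto.
    all: intros y Hy; apply Rmult_le_compat_r; [left; apply poisson_pos; auto | apply Hnear; lra]. }
  rewrite C1. destruct Hm1 as [Hm1 Hm2].
  assert (phi x * (1 - m) <= gam / 4). { eapply Rle_trans; [|exact E1]. apply Rmult_le_compat_l; lra. }
  apply Rabs_le. assert (- A <= x - r) by lra. assert (x + r <= A) by lra.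
  specialize (F1 H2). specialize (F2 H3).
  assert (0 <= RInt F (- A) (x - r) <= mass phi * (eps / r ^ 2)) by (apply F1; lra).
  assert (0 <= RInt F (x + r) A <= mass phi * (eps / r ^ 2)) by (apply F2; lra).
  split; nra.
Qed.

Lemma Cmod_sub_triangle (a b c : C) : Cmod (Cminus a c) <= Cmod (Cminus a b) + Cmod (Cminus b c).
Proof.
  replace (Cminus a c) with (Cplus (Cminus a b) (Cminus b c)) by ring. apply Cmod_triangle.
Qed.

(** Both sides are compared with one double integral over [[-A, A]] in space and [[-B, B]] in
    frequency. The first error truncates the transform of [phi], uniformly over a frequency range of
    length [2 B]; the second, after Fubini, truncates the transform of [damp]. *)
Lemma damped_hat_poisson phi x eps B A : phi_hyp phi -> 0 < eps -> 1 <= B -> 0 <= A ->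
  Cmod (Cminus (CI (fun y => Cmult (fourier1 phi y) (Cmult (RtoC (damp eps y)) (expi (2 * PI * (x * y))))) (- 1) 1)
     (RtoC (RInt (fun s => phi s * poisson eps (x - s)) (- A) A)))
   <= 2 * B * (mass phi - RInt phi (- A) A) + mass phi * (2 * exp (- eps * B) / eps).
Proof.
  intros H He HB HA.
  set (g := fun y => Cmult (RtoC (damp eps y)) (expi (2 * PI * (x * y)))).
  change (fun y => Cmult (fourier1 phi y) (Cmult (RtoC (damp eps y)) (expi (2 * PI * (x * y))))) with
    (fun y => Cmult (fourier1 phi y) (g y)).
  assert (Hg : ccont g).
  { apply ccont_mult. apply ccont_RtoC; intros; apply damp_cont. apply ccont_expi; cont_auto. }
  assert (Hg1 : forall y, Cmod (g y) <= 1).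
  { intros y. unfold g. rewrite Cmod_mult, Cmod_expi, Cmod_R, Rmult_1_r. apply damp_bound; lra. }
  assert (Hh := hat_ccont phi H).
  assert (Hhg : ccont (fun y => Cmult (fourier1 phi y) (g y))) by (apply ccont_mult; auto).
  (* The transform vanishes beyond 1, so the range may grow to [[-B, B]]; a large [B] is what makes
     the inner integral close to the Poisson kernel. *)
  replace (CI (fun y => Cmult (fourier1 phi y) (g y)) (- 1) 1) with (CI (fun y => Cmult (fourier1 phi y) (g y)) (- B) B).
  2:{ assert (Z : forall u v, u <= v -> (v <= -1 \/ 1 <= u) -> CI (fun y => Cmult (fourier1 phi y) (g y)) u v = RtoC 0).
      { intros u v Huv Hd. rewrite (CI_ext _ (fun _ => RtoC 0)). apply CI_0.
        intros y. rewrite Rmin_left, Rmax_right by lra. intros Hy.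
        rewrite hat_supp; auto. ring. destruct Hd; [rewrite Rabs_left|rewrite Rabs_right]; lra. }
      rewrite <- (CI_Chasles _ (- B) (-1) B), <- (CI_Chasles _ (-1) 1 B) by auto.
      rewrite (Z (- B)), (Z 1) by lra. ring. }
  set (f2 := fun s y => Cmult (RtoC (phi s)) (Cmult (g y) (expi (- (2 * PI) * ((s + 0) * y))))).
  assert (Hf2 : ccont2 f2).
  { apply ccont2_mult. apply (ccont2_fst (fun s => RtoC (phi s))). apply ccont_RtoC, phi_cont, H.
    apply ccont2_mult. apply ccont2_snd; auto. apply ccont2_expi_bilin. }
  apply Rle_trans with (1 := Cmod_sub_triangle _ (CI (fun y => CI (fun s => f2 s y) (- A) A) (- B) B) _).
  apply Rplus_le_compat.
  - rewrite <- CI_minus; auto.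
    2:{ apply CI_param_ccont; auto. lra. }
    replace (2 * B * (mass phi - RInt phi (- A) A)) with ((B - - B) * (mass phi - RInt phi (- A) A)) by ring.
    apply CI_le_const. lra.
    { apply ccont_ext with (f := fun y => Cplus (Cmult (fourier1 phi y) (g y)) (Cmult (Copp (RtoC 1)) (CI (fun s => f2 s y) (- A) A))).
      intros; ring. apply ccont_plus; auto. apply ccont_mult. apply ccont_const. apply CI_param_ccont; auto. lra. }
    intros y _.
    replace (CI (fun s => f2 s y) (- A) A) with (Cmult (g y) (CI (wave phi (- y)) (- A) A)).
    2:{ rewrite <- CI_mult by (apply wave_ccont; auto). apply CI_ext. intros s _. unfold f2, wave.
        replace (2 * PI * (s * - y)) with (- (2 * PI) * ((s + 0) * y)) by ring. ring. }
    replace (Cminus (Cmult (fourier1 phi y) (g y)) (Cmult (g y) (CI (wave phi (- y)) (- A) A))) with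
      (Cmult (Copp (g y)) (Cminus (CI (wave phi (- y)) (- A) A) (fourier1 phi y))) by ring.
    rewrite Cmod_mult, Cmod_opp.
    generalize (hat_tail phi (- y) (- A) A H). rewrite Ropp_involutive. intros HT.
    specialize (Hg1 y). generalize (Cmod_ge_0 (g y)). intros.
    assert (HT' := HT ltac:(lra)). generalize (Cmod_ge_0 (Cminus (CI (wave phi (- y)) (- A) A) (fourier1 phi y))). nra.
  - rewrite CI_Fubini by (auto; lra).
    assert (HP : forall s, continuous (fun s => phi s * poisson eps (x - s)) s).
    { intros s. apply (continuous_mult (K := R_AbsRing)). apply phi_cont, H. apply poisson_cont; auto. }
    replace (RtoC (RInt (fun s => phi s * poisson eps (x - s)) (- A) A)) with
      (CI (fun s => RtoC (phi s * poisson eps (x - s))) (- A) A).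
    2:{ apply CI_unique, is_RInt_C; simpl. apply RI_is; auto.
        generalize (is_RInt_const (V := R_NormedModule) (- A) A 0).
        unfold scal; simpl; unfold mult; simpl. rewrite Rmult_0_r; auto. }
    assert (HR : ccont (fun s => RtoC (phi s * poisson eps (x - s)))) by (apply ccont_RtoC; auto).
    assert (HL : ccont (fun s => CI (fun y => f2 s y) (- B) B)).
    { apply (CI_param_ccont (fun y s => f2 s y)). apply ccont2_swap; auto. lra. }
    rewrite <- CI_minus by auto.
    apply Rle_trans with (RInt (fun s => (2 * exp (- eps * B) / eps) * phi s) (- A) A).
    + apply CI_le. lra.
      { apply ccont_ext with (f := fun s => Cplus (CI (fun y => f2 s y) (- B) B) (Cmult (Copp (RtoC 1)) (RtoC (phi s * poisson eps (x - s))))).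
        intros; ring. apply ccont_plus; auto. apply ccont_mult; auto. apply ccont_const. }
      { intros s. apply (continuous_scal_r (V := R_NormedModule)). apply phi_cont, H. }
      intros s _.
      replace (CI (fun y => f2 s y) (- B) B) with (Cmult (RtoC (phi s))
         (CI (fun y => Cmult (RtoC (damp eps y)) (expi (2 * PI * (x - s) * y))) (- B) B)).
      2:{ rewrite <- CI_mult.
          - apply CI_ext. intros y _. unfold f2, g. f_equal.
            rewrite <- Cmult_assoc, <- expi_plus. do 2 f_equal. ring.
          - apply ccont_mult. apply ccont_RtoC; intros; apply damp_cont. apply ccont_expi; cont_auto. }
      rewrite RtoC_mult.
      match goal with |- Cmod (Cminus (Cmult ?p ?a) (Cmult ?p ?b)) <= _ =>
        replace (Cminus (Cmult p a) (Cmult p b)) with (Cmult p (Cminus a b)) by ring end.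
      rewrite Cmod_mult, Cmod_R, Rabs_right by (left; apply phi_pos, H).
      rewrite Rmult_comm. apply Rmult_le_compat_r. left; apply phi_pos, H.
      apply poisson_approx; lra.
    + rewrite RInt_scal_cont by (apply phi_cont, H). rewrite Rmult_comm.
      apply Rmult_le_compat_r.
      * left. apply Rdiv_lt_0_compat; auto. generalize (exp_pos (- eps * B)); lra.
      * apply RInt_phi_le_mass; auto. lra.
Qed.

Lemma damped_hat_limit phi x eps gam : phi_hyp phi -> 0 < eps -> 0 < gam ->
  exists A0, forall A, A0 <= A ->
  Cmod (Cminus (CI (fun y => Cmult (fourier1 phi y) (Cmult (RtoC (damp eps y)) (expi (2 * PI * (x * y))))) (- 1) 1)
     (RtoC (RInt (fun s => phi s * poisson eps (x - s)) (- A) A))) <= gam.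
Proof.
  intros H He Hg. assert (Hm := mass_pos phi H).
  (* By [exp (- z) <= / z], this [B] brings the second error below [gam / 2]. It is fixed before
     [A], since the first error grows with [B]. *)
  set (B := 1 + 4 * mass phi / (eps * eps * gam)).
  assert (Hee : 0 < eps * eps * gam) by (apply Rmult_lt_0_compat; nra).
  assert (HB0 : 0 < 4 * mass phi / (eps * eps * gam)) by (apply Rdiv_lt_0_compat; lra).
  assert (HB : 1 <= B) by (unfold B; lra).
  assert (E : mass phi * (2 * exp (- eps * B) / eps) <= gam / 2).
  { assert (HeB : 0 < eps * B) by nra.
    assert (exp (- eps * B) <= / (eps * B)).
    { replace (- eps * B) with (- (eps * B)) by ring. rewrite exp_Ropp.
      apply Rinv_le_contravar; auto. generalize (exp_ineq1_le (eps * B)); lra. }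
    apply Rle_trans with (mass phi * (2 * / (eps * B) / eps)).
    - apply Rmult_le_compat_l. lra. apply Rmult_le_compat_r. left; apply Rinv_0_lt_compat; auto. lra.
    - apply Rmult_le_reg_r with (eps * eps * B). nra.
      replace (mass phi * (2 * / (eps * B) / eps) * (eps * eps * B)) with (2 * mass phi) by (field; lra).
      unfold B. replace (gam / 2 * (eps * eps * (1 + 4 * mass phi / (eps * eps * gam)))) with
        (gam / 2 * (eps * eps) + 2 * mass phi) by (field; lra). nra. }
  destruct (mass_approx phi H (gam / (4 * B))) as [A0 [HA0 HA]].
  { apply Rdiv_lt_0_compat; lra. }
  exists A0. intros A HAA.
  eapply Rle_trans. apply (damped_hat_poisson phi x eps B A); auto; lra.
  assert (HA' := HA (- A) A ltac:(lra) HAA). apply Rabs_le_between in HA'.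
  assert (2 * B * (mass phi - RInt phi (- A) A) <= 2 * B * (gam / (4 * B))).
  { apply Rmult_le_compat_l; lra. }
  replace (2 * B * (gam / (4 * B))) with (gam / 2) in * by (field; lra). lra.
Qed.

Lemma fourier_inversion phi x : phi_hyp phi ->
  CI (fun y => Cmult (fourier1 phi y) (expi (2 * PI * (x * y)))) (- 1) 1 = RtoC (phi x).
Proof.
  intros H. assert (Hm := mass_pos phi H).
  set (L0 := CI _ _ _).
  assert (P : forall gam, 0 < gam -> Cmod (Cminus L0 (RtoC (phi x))) <= 3 * gam).
  { intros gam Hg.
    destruct (poisson_identity phi x gam H Hg) as [e0 [He0 Hpi]].
    (* On [[-1, 1]] removing the damping changes the integral by at most [2 * mass phi * eps], hence
       by at most [gam]. *)
    set (eps := Rmin e0 (gam / (2 * mass phi))).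
    assert (He : 0 < eps). { apply Rmin_glb_lt; auto. apply Rdiv_lt_0_compat; lra. }
    destruct (Hpi eps He (Rmin_l _ _)) as [A1 HA1].
    destruct (damped_hat_limit phi x eps gam H He Hg) as [A2 HA2].
    specialize (HA1 _ (Rmax_l A1 A2)). specialize (HA2 _ (Rmax_r A1 A2)).
    set (A := Rmax A1 A2) in *.
    set (Le := CI _ _ _) in HA2.
    set (I := RInt _ _ _) in *.
    assert (E : Cmod (Cminus L0 Le) <= gam).
    { unfold L0, Le.
      assert (Hh := hat_ccont phi H).
      assert (He1 : ccont (fun y => expi (2 * PI * (x * y)))) by (apply ccont_expi; cont_auto).
      assert (Hd : ccont (fun y => RtoC (damp eps y))) by (apply ccont_RtoC; intros; apply damp_cont).
      assert (Hc1 := ccont_mult _ _ Hh He1). assert (Hc2 := ccont_mult _ _ Hh (ccont_mult _ _ Hd He1)).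
      rewrite <- CI_minus by auto.
      eapply Rle_trans.
      - apply (CI_le_const _ (- 1) 1 (mass phi * eps)). lra.
        + apply ccont_ext with (f := fun y => Cplus (Cmult (fourier1 phi y) (expi (2 * PI * (x * y))))
             (Cmult (Copp (RtoC 1)) (Cmult (fourier1 phi y) (Cmult (RtoC (damp eps y)) (expi (2 * PI * (x * y))))))).
          intros; ring. apply ccont_plus; auto. apply (ccont_mult _ _ (ccont_const _) Hc2).
        + intros y Hy.
          match goal with |- Cmod ?z <= _ => replace z with
            (Cmult (fourier1 phi y) (Cmult (Copp (RtoC (damp eps y - 1))) (expi (2 * PI * (x * y))))) end.
          2:{ rewrite RtoC_minus. ring. }
          rewrite !Cmod_mult, Cmod_expi, Rmult_1_r, Cmod_opp, Cmod_R.
          apply Rmult_le_compat; try apply Cmod_ge_0; try apply Rabs_pos.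
          apply hat_le_mass; auto. apply damp_near_1. lra. apply Rabs_le; lra.
      - apply Rle_trans with ((1 - -1) * (mass phi * (gam / (2 * mass phi)))).
        + apply Rmult_le_compat_l. lra. apply Rmult_le_compat_l. lra. apply Rmin_r.
        + right; field; lra. }
    assert (E3 : Cmod (Cminus (RtoC I) (RtoC (phi x))) <= gam).
    { rewrite <- RtoC_minus, Cmod_R. exact HA1. }
    generalize (Cmod_sub_triangle L0 Le (RtoC (phi x))) (Cmod_sub_triangle Le (RtoC I) (RtoC (phi x))). lra. }
  assert (Z : Cmod (Cminus L0 (RtoC (phi x))) = 0).
  { apply Rle_antisym; [|apply Cmod_ge_0]. apply le_epsilon. intros e He. specialize (P (e / 3)). lra. }
  apply Cmod_eq_0 in Z. replace L0 with (Cplus (Cminus L0 (RtoC (phi x))) (RtoC (phi x))) by ring.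
  rewrite Z. ring.
Qed.

(** Inversion writes [phi x] as an integral over an interval of length 2 of a function bounded by
    [mass phi]. This makes [phi ^ 2] dominated by a multiple of [phi]. *)
Lemma phi_le_mass phi x : phi_hyp phi -> phi x <= 2 * mass phi.
Proof.
  intros H. assert (Hm := mass_pos phi H).
  rewrite <- (Rabs_right (phi x)) by (left; apply phi_pos, H).
  rewrite <- Cmod_R, <- fourier_inversion by auto.
  replace (2 * mass phi) with ((1 - -1) * mass phi) by ring.
  apply CI_le_const. lra.
  - apply ccont_mult. apply hat_ccont; auto. apply ccont_expi; cont_auto.
  - intros y _. rewrite Cmod_mult, Cmod_expi, Rmult_1_r. apply hat_le_mass; auto.
Qed.

(** * The weight [phi^2]: total mass and orthogonality *)

Lemma phi2_exists phi : phi_hyp phi ->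
  exists Q, 0 < Q /\ lineint (fun x => RtoC (phi x ^ 2)) (RtoC Q).
Proof.
  intros H. assert (Hm := mass_pos phi H). assert (Hp := phi_pos phi H).
  assert (Hc : forall x, continuous (fun x => phi x ^ 2) x).
  { intros x. apply continuous_ext with (f := fun x => phi x * phi x). intros; simpl; ring.
    apply (continuous_mult (K := R_AbsRing)); apply phi_cont, H. }
  assert (HC := ccont_RtoC _ Hc).
  assert (Hd : forall x, Cmod (RtoC (phi x ^ 2)) <= 2 * mass phi * phi x).
  { intros x. rewrite Cmod_R, Rabs_right. 2:{ apply Rle_ge, pow2_ge_0. }
    generalize (phi_le_mass phi x H) (Hp x). nra. }
  destruct (dom_exists phi _ _ H HC Hd) as [I HI].
  assert (Pf : forall a b, CI (fun x => RtoC (phi x ^ 2)) a b = RtoC (RInt (fun x => phi x ^ 2) a b)).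
  { intros a b. apply CI_unique, is_RInt_C; simpl. apply RI_is; auto.
        generalize (is_RInt_const (V := R_NormedModule) a b 0).
        unfold scal; simpl; unfold mult; simpl. rewrite Rmult_0_r; auto. }
  set (q0 := RInt (fun x => phi x ^ 2) (-1) 1).
  assert (Hq0 : 0 < q0).
  { apply RInt_gt_0; auto. lra. intros. apply pow_lt, Hp. }
  assert (Mono : forall A, 1 <= A -> q0 <= RInt (fun x => phi x ^ 2) (- A) A).
  { intros A HA.
    rewrite <- (RInt_Chasles (V := R_CompleteNormedModule) (fun x => phi x ^ 2) (- A) (-1) A),
      <- (RInt_Chasles (V := R_CompleteNormedModule) (fun x => phi x ^ 2) (-1) 1 A);
      try (eexists; apply RI_is; auto).
    assert (0 <= RInt (fun x => phi x ^ 2) (- A) (-1)).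
    { apply RInt_ge_0. lra. eexists; apply RI_is; auto. intros; apply pow2_ge_0. }
    assert (0 <= RInt (fun x => phi x ^ 2) 1 A).
    { apply RInt_ge_0. lra. eexists; apply RI_is; auto. intros; apply pow2_ge_0. }
    unfold plus; simpl. unfold q0. simpl in *. lra. }
  (* The limit is a priori a complex number; all truncations are real and eventually at least [q0],
     and both properties pass to the limit. *)
  assert (Him : snd I = 0 /\ q0 <= fst I).
  { assert (HE : forall eps, 0 < eps -> Rabs (snd I) <= eps /\ q0 <= fst I + eps).
    { intros eps He. destruct (lineint_elim _ _ HI eps He) as [A [HA0 HA]].
      specialize (HA (- Rmax 1 A) (Rmax 1 A)).
      generalize (Rmax_l 1 A) (Rmax_r 1 A); intros.
      assert (HA' := HA ltac:(lra) ltac:(lra)). rewrite Pf in HA'.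
      specialize (Mono _ H0).
      set (r := RInt (fun x => phi x ^ 2) (- Rmax 1 A) (Rmax 1 A)) in *.
      assert (HM := Rle_trans _ _ _ (Rmax_Cmod (Cminus (RtoC r) I)) HA').
      assert (M1 := Rle_trans _ _ _ (Rmax_l _ _) HM). assert (M2 := Rle_trans _ _ _ (Rmax_r _ _) HM).
      simpl in M1, M2. rewrite Rplus_0_l, Rabs_Ropp in M2. split. lra.
      generalize (Rle_abs (r + - fst I)). lra. }
    split.
    - destruct (Req_dec (snd I) 0); auto. assert (0 < Rabs (snd I)) by (apply Rabs_pos_lt; auto).
      destruct (HE (Rabs (snd I) / 2)); lra.
    - apply le_epsilon. intros. apply HE; auto. }
  exists (fst I). split. lra.
  replace (RtoC (fst I)) with I; auto. apply Ceq; simpl; tauto.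
Qed.

(** Inversion is substituted for one of the two factors [phi]. The other then yields the transform
    at [- (y + m)] with [|y| <= 1], which vanishes because [|y + m| >= 1]. *)
Lemma phi2_orthogonal phi m : phi_hyp phi -> 2 <= Rabs m ->
  lineint (fun x => Cmult (RtoC (phi x ^ 2)) (expi (2 * PI * (m * x)))) (RtoC 0).
Proof.
  intros H Hm. assert (Hms := mass_pos phi H).
  assert (Hc : ccont (fun x => Cmult (RtoC (phi x ^ 2)) (expi (2 * PI * (m * x))))).
  { apply ccont_mult. 2: apply ccont_expi; cont_auto.
    apply ccont_RtoC. intros x. apply continuous_ext with (f := fun x => phi x * phi x). intros; simpl; ring.
    apply (continuous_mult (K := R_AbsRing)); apply phi_cont, H. }
  assert (Hh := hat_ccont phi H).
  apply lineint_intro; auto. intros eps He.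
  destruct (mass_approx phi H (eps / (2 * mass phi))) as [A [HA0 HA]]. { apply Rdiv_lt_0_compat; lra. }
  exists A. intros a b Ha Hb. specialize (HA a b Ha Hb). apply Rabs_le_between in HA.
  set (f2 := fun y x => Cmult (fourier1 phi y) (Cmult (RtoC (phi x)) (expi (2 * PI * ((y + m) * x))))).
  assert (Hf2 : ccont2 f2).
  { apply ccont2_mult. apply ccont2_fst; auto. apply ccont2_mult.
    apply (ccont2_snd (fun s => RtoC (phi s))). apply ccont_RtoC, phi_cont, H. apply ccont2_expi_bilin. }
  replace (Cminus (CI (fun x => Cmult (RtoC (phi x ^ 2)) (expi (2 * PI * (m * x)))) a b) 0)
   with (CI (fun x => CI (fun y => f2 y x) (-1) 1) a b).
  2:{ transitivity (CI (fun x => Cmult (RtoC (phi x ^ 2)) (expi (2 * PI * (m * x)))) a b); [|ring].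
      apply CI_ext. intros x _.
      transitivity (Cmult (Cmult (RtoC (phi x)) (expi (2 * PI * (m * x)))) (RtoC (phi x))).
      - rewrite <- (fourier_inversion phi x H), <- CI_mult.
        + apply CI_ext. intros y _. unfold f2.
          replace (2 * PI * ((y + m) * x)) with (2 * PI * (x * y) + 2 * PI * (m * x)) by ring.
          rewrite expi_plus. rewrite (fourier_inversion phi x H). ring.
        + apply ccont_mult; auto. apply ccont_expi; cont_auto.
      - simpl pow. rewrite !RtoC_mult. ring. }
  rewrite CI_Fubini by (auto; lra).
  eapply Rle_trans.
  - apply (CI_le_const _ (-1) 1 (mass phi * (eps / (2 * mass phi)))). lra.
    { apply (CI_param_ccont (fun x y => f2 y x)). apply ccont2_swap; auto. lra. }
    intros y Hy.
    replace (CI (fun x => f2 y x) a b) with (Cmult (fourier1 phi y) (CI (wave phi (y + m)) a b)).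
    2:{ rewrite <- CI_mult by (apply wave_ccont; auto). apply CI_ext. intros x _. unfold f2, wave.
        replace (x * (y + m)) with ((y + m) * x) by ring. ring. }
    rewrite Cmod_mult. apply Rmult_le_compat; try apply Cmod_ge_0. apply hat_le_mass; auto.
    generalize (hat_tail phi (y + m) a b H). rewrite hat_supp; auto.
    + replace (Cminus (CI (wave phi (y + m)) a b) 0) with (CI (wave phi (y + m)) a b) by ring.
      intros HT. specialize (HT ltac:(lra)). lra.
    + rewrite Rabs_Ropp. unfold Rabs in *. destruct (Rcase_abs m), (Rcase_abs (y + m)); lra.
  - right. field. lra.
Qed.

(** * Exponential sums *)

Fixpoint csum (f : nat -> C) (n : nat) : C :=
  match n with O => RtoC 0 | S m => Cplus (csum f m) (f m) end.
Fixpoint rsum (f : nat -> R) (n : nat) : R :=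
  match n with O => 0 | S m => rsum f m + f m end.

Lemma csum_ext f g n : (forall k, (k < n)%nat -> f k = g k) -> csum f n = csum g n.
Proof. induction n; simpl; intros H; auto. rewrite IHn, (H n); auto. Qed.

Lemma csum_plus f g n : csum (fun k => Cplus (f k) (g k)) n = Cplus (csum f n) (csum g n).
Proof. induction n; simpl; [|rewrite IHn]; ring. Qed.

Lemma csum_mult c f n : csum (fun k => Cmult c (f k)) n = Cmult c (csum f n).
Proof. induction n; simpl; [|rewrite IHn]; ring. Qed.

Lemma csum_conj f n : Cconj (csum f n) = csum (fun k => Cconj (f k)) n.
Proof.
  induction n; simpl. apply Ceq; simpl; ring.
  rewrite Cplus_conj, IHn; reflexivity.
Qed.

Lemma csum_add f m n : csum f (m + n) = Cplus (csum f m) (csum (fun k => f (m + k)%nat) n).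
Proof.
  induction n; simpl. rewrite Nat.add_0_r; ring.
  rewrite Nat.add_succ_r; simpl. rewrite IHn; ring.
Qed.

Lemma csum_swap (f : nat -> nat -> C) m n :
  csum (fun i => csum (fun j => f i j) n) m = csum (fun j => csum (fun i => f i j) m) n.
Proof.
  induction m; simpl.
  - induction n; simpl; auto. rewrite <- IHn; ring.
  - rewrite IHm, <- csum_plus. reflexivity.
Qed.

Lemma csum_rev f n : csum (fun k => f (n - 1 - k)%nat) n = csum f n.
Proof.
  induction n; auto.
  change (csum (fun k => f (S n - 1 - k)%nat) (1 + n) = Cplus (csum f n) (f n)).
  rewrite csum_add, (csum_ext (fun k => f (S n - 1 - (1 + k))%nat) (fun k => f (n - 1 - k)%nat)).
  2:{ intros k Hk. f_equal. lia. }
  rewrite IHn. simpl. replace (n - 0 - 0)%nat with n by lia. ring.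
Qed.

Lemma Cmod_csum f n : Cmod (csum f n) <= rsum (fun k => Cmod (f k)) n.
Proof.
  induction n; simpl. rewrite Cmod_0; lra.
  eapply Rle_trans. apply Cmod_triangle. lra.
Qed.

Lemma rsum_le f g n : (forall k, (k < n)%nat -> f k <= g k) -> rsum f n <= rsum g n.
Proof.
  induction n; simpl; intros H. lra.
  assert (f n <= g n) by auto. assert (rsum f n <= rsum g n) by auto. lra.
Qed.

Lemma rsum_ext f g n : (forall k, (k < n)%nat -> f k = g k) -> rsum f n = rsum g n.
Proof. induction n; simpl; intros H; auto. rewrite IHn, (H n); auto. Qed.

Lemma rsum_const c n : rsum (fun _ => c) n = INR n * c.
Proof. induction n. simpl; ring. simpl rsum. rewrite IHn, S_INR; ring. Qed.

Lemma rsum_nonneg f n : (forall k, (k < n)%nat -> 0 <= f k) -> 0 <= rsum f n.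
Proof.
  induction n; simpl; intros H. lra. assert (0 <= f n) by auto. assert (0 <= rsum f n) by auto. lra.
Qed.

Lemma rsum_add f m n : rsum f (m + n) = rsum f m + rsum (fun k => f (m + k)%nat) n.
Proof.
  induction n; simpl. rewrite Nat.add_0_r; ring.
  rewrite Nat.add_succ_r; simpl. rewrite IHn; ring.
Qed.

Lemma rsum_plus f g n : rsum (fun k => f k + g k) n = rsum f n + rsum g n.
Proof. induction n; simpl; [|rewrite IHn]; ring. Qed.

Lemma rsum_mult c f n : rsum (fun k => c * f k) n = c * rsum f n.
Proof. induction n; simpl; [|rewrite IHn]; ring. Qed.

Lemma rsum_rev f n : rsum (fun k => f (n - 1 - k)%nat) n = rsum f n.
Proof.
  induction n; auto.
  change (rsum (fun k => f (S n - 1 - k)%nat) (1 + n) = rsum f n + f n).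
  rewrite rsum_add, (rsum_ext (fun k => f (S n - 1 - (1 + k))%nat) (fun k => f (n - 1 - k)%nat)).
  2:{ intros k Hk. f_equal. lia. }
  rewrite IHn. simpl. replace (n - 0 - 0)%nat with n by lia. ring.
Qed.

Lemma rsum_list f n : rsum f n = fold_right Rplus 0 (map f (seq 0 n)).
Proof.
  assert (P : forall l x, fold_right Rplus 0 (l ++ x :: nil) = fold_right Rplus 0 l + x).
  { induction l; intros; simpl. ring. rewrite IHl; ring. }
  induction n; auto. rewrite seq_S, map_app. simpl map. rewrite P, <- IHn. reflexivity.
Qed.

Lemma fold_Rplus_perm l l' : Permutation l l' -> fold_right Rplus 0 l = fold_right Rplus 0 l'.
Proof. induction 1; simpl; try lra. Qed.

(** * Weyl differencing *)

Lemma norm2_csum_expand (a : nat -> C) n :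
  Cmult (csum a n) (Cconj (csum a n)) =
  let D := csum (fun h => csum (fun k => Cmult (a (k + h + 1)%nat) (Cconj (a k))) (n - 1 - h)) n in
  Cplus (csum (fun k => Cmult (a k) (Cconj (a k))) n) (Cplus D (Cconj D)).
Proof.
  induction n. { simpl. apply Ceq; simpl; ring. }
  cbv zeta in *.
  set (D := fun n => csum (fun h => csum (fun k => Cmult (a (k + h + 1)%nat) (Cconj (a k))) (n - 1 - h)) n).
  change (Cmult (csum a n) (Cconj (csum a n)) = Cplus (csum (fun k => Cmult (a k) (Cconj (a k))) n) (Cplus (D n) (Cconj (D n)))) in IHn.
  change (Cmult (csum a (S n)) (Cconj (csum a (S n))) = Cplus (csum (fun k => Cmult (a k) (Cconj (a k))) (S n)) (Cplus (D (S n)) (Cconj (D (S n))))).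
  (* Passing to [n + 1] terms, the correlation of lag [h + 1] gains the single product of [a n] with
     the conjugate of [a (n - 1 - h)]; summed over [h] in reverse order these form the conjugate of
     the old sum. *)
  assert (E : D (S n) = Cplus (D n) (Cmult (a n) (Cconj (csum a n)))).
  { unfold D. simpl csum at 1. replace (n - 0 - n)%nat with 0%nat by lia. simpl csum at 2.
    rewrite csum_conj, <- (csum_rev (fun k => Cconj (a k))), <- csum_mult.
    rewrite Cplus_0_r, <- csum_plus. apply csum_ext. intros h Hh.
    replace (n - 0 - h)%nat with (S (n - 1 - h)) by lia. simpl. do 3 f_equal. lia. }
  rewrite E. simpl csum. rewrite !Cplus_conj, !Cmult_conj, Cconj_conj.
  transitivity (Cplus (Cmult (csum a n) (Cconj (csum a n))) (Cplus (Cmult (a n) (Cconj (a n)))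
    (Cplus (Cmult (a n) (Cconj (csum a n))) (Cmult (csum a n) (Cconj (a n)))))). ring.
  rewrite IHn. ring.
Qed.

Lemma weyl_differencing (a : nat -> C) n :
  Cmod (csum a n) ^ 2 <= rsum (fun k => Cmod (a k) ^ 2) n +
   2 * rsum (fun h => Cmod (csum (fun k => Cmult (a (k + h + 1)%nat) (Cconj (a k))) (n - 1 - h))) n.
Proof.
  assert (E := norm2_csum_expand a n). cbv zeta in E.
  set (D := csum (fun h => csum (fun k => Cmult (a (k + h + 1)%nat) (Cconj (a k))) (n - 1 - h)) n) in E.
  replace (Cmod (csum a n) ^ 2) with (Cmod (Cmult (csum a n) (Cconj (csum a n)))).
  2:{ rewrite Cmod_mult, Cmod_conj. ring. }
  rewrite E.
  eapply Rle_trans. apply Cmod_triangle.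
  apply Rplus_le_compat.
  - eapply Rle_trans. apply Cmod_csum. apply rsum_le. intros k _. rewrite Cmod_mult, Cmod_conj. right; ring.
  - eapply Rle_trans. apply Cmod_triangle. rewrite Cmod_conj.
    assert (Cmod D <= rsum (fun h => Cmod (csum (fun k => Cmult (a (k + h + 1)%nat) (Cconj (a k))) (n - 1 - h))) n) by apply Cmod_csum.
    lra.
Qed.

(** * Additive characters modulo [q] and geometric sums *)

Definition eZ (q m : Z) : C := expi (2 * PI * (IZR m / IZR q)).

Lemma expi_nat n : expi (2 * PI * INR n) = RtoC 1.
Proof.
  induction n. simpl. rewrite Rmult_0_r. apply expi_0.
  rewrite S_INR, Rmult_plus_distr_l, expi_plus, IHn, Rmult_1_r.
  unfold expi. rewrite cos_2PI, sin_2PI. apply Ceq; simpl; ring.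
Qed.

Lemma expi_conj x : Cconj (expi x) = expi (- x).
Proof. unfold expi, Cconj. simpl. rewrite cos_neg, sin_neg. reflexivity. Qed.

Lemma expi_Z m : expi (2 * PI * IZR m) = RtoC 1.
Proof.
  destruct (Z_le_gt_dec 0 m).
  - rewrite <- (Z2Nat.id m), <- INR_IZR_INZ by auto. apply expi_nat.
  - replace (2 * PI * IZR m) with (- (2 * PI * IZR (- m))) by (rewrite opp_IZR; ring).
    rewrite <- expi_conj, <- (Z2Nat.id (- m)), <- INR_IZR_INZ, expi_nat by lia.
    apply Ceq; simpl; ring.
Qed.

Lemma eZ_add q m m' : eZ q (m + m') = Cmult (eZ q m) (eZ q m').
Proof. unfold eZ. rewrite <- expi_plus, plus_IZR. f_equal. unfold Rdiv; ring. Qed.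

Lemma eZ_conj q m : Cconj (eZ q m) = eZ q (- m).
Proof. unfold eZ. rewrite expi_conj, opp_IZR. f_equal. unfold Rdiv; ring. Qed.

Lemma eZ_mod1 q m : Cmod (eZ q m) = 1.
Proof. apply Cmod_expi. Qed.

Lemma eZ_div q m : q <> 0%Z -> (q | m)%Z -> eZ q m = RtoC 1.
Proof.
  intros Hq [k ->]. unfold eZ. rewrite <- (expi_Z k). f_equal. rewrite mult_IZR. field.
  apply eq_IZR_contrapositive; auto.
Qed.

Lemma eZ_cong q m m' : q <> 0%Z -> (q | m - m')%Z -> eZ q m = eZ q m'.
Proof.
  intros Hq Hd. replace m with ((m - m') + m')%Z by ring. rewrite eZ_add, (eZ_div q (m - m')); auto. ring.
Qed.

Lemma eZ_0 q : eZ q 0 = RtoC 1.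
Proof. unfold eZ. unfold Rdiv. rewrite Rmult_0_l, Rmult_0_r. apply expi_0. Qed.

Lemma eZ_chord q m : Cmod (Cminus (eZ q m) 1) = 2 * Rabs (sin (PI * (IZR m / IZR q))).
Proof.
  rewrite <- expi_0. unfold eZ. rewrite expi_chord. do 3 f_equal. set (z := IZR m / IZR q). field.
Qed.

Lemma eZ_geom q m n :
  Cmult (Cminus (eZ q m) 1) (csum (fun k => eZ q (m * Z.of_nat k)) n) = Cminus (eZ q (m * Z.of_nat n)) 1.
Proof.
  induction n. { simpl. rewrite Z.mul_0_r, eZ_0. ring. }
  simpl csum. rewrite Cmult_plus_distr_l, IHn.
  replace (m * Z.of_nat (S n))%Z with (m + m * Z.of_nat n)%Z by lia. rewrite eZ_add. ring.
Qed.

(** Up to [PI / 3] the cosine is at least 1/2 and the mean value theorem applies; beyond, the sine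
    exceeds 1/2, which dominates [x / 4] since [PI <= 4]. *)
Lemma sin_ge_quarter x : 0 <= x <= PI / 2 -> x / 4 <= sin x.
Proof.
  intros Hx. assert (HPI := PI_4). assert (HP0 := PI_RGT_0).
  destruct (Req_dec x 0) as [->|Hn]. rewrite sin_0; lra.
  destruct (Rle_dec x (PI / 3)).
  - destruct (MVT_cor2 sin cos 0 x) as [c [Hc1 Hc2]]. lra.
    { intros; apply derivable_pt_lim_sin. }
    rewrite sin_0 in Hc1.
    assert (1 / 2 <= cos c). { rewrite <- cos_PI3. left; apply cos_decreasing_1; lra. }
    nra.
  - assert (sin (PI / 6) < sin x). { apply sin_increasing_1; lra. }
    rewrite sin_PI6 in H. lra.
Qed.

(** Only the nearer endpoint matters for each [r], but keeping both reciprocals turns the sum over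
    residues into two harmonic sums without a case split. *)
Lemma sin_ratio_lower (q r : R) : 0 < r < q -> / sin (PI * (r / q)) <= 2 * q * (/ r + / (q - r)).
Proof.
  intros Hr. assert (HP0 := PI_RGT_0). assert (HP2 : 2 < PI) by (generalize PI2_1; lra).
  assert (P : forall r, 0 < r <= q / 2 -> / sin (PI * (r / q)) <= 2 * q * / r).
  { intros s Hs. assert (0 < PI * (s / q)). { apply Rmult_lt_0_compat; auto. apply Rdiv_lt_0_compat; lra. }
    assert (PI * (s / q) <= PI / 2).
    { apply Rmult_le_compat_l. lra. apply Rmult_le_reg_r with q. lra. replace (s / q * q) with s by (field; lra). lra. }
    assert (Hs1 := sin_ge_quarter (PI * (s / q)) ltac:(lra)).
    apply Rle_trans with (/ (PI * (s / q) / 4)). apply Rinv_le_contravar; lra.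
    replace (2 * q * / s) with (/ (2 * (s / q) / 4)) by (field; lra).
    assert (0 < s / q) by (apply Rdiv_lt_0_compat; lra).
    apply Rinv_le_contravar. lra. apply Rmult_le_compat_r. lra. apply Rmult_le_compat_r; lra. }
  assert (0 < / r) by (apply Rinv_0_lt_compat; lra). assert (0 < / (q - r)) by (apply Rinv_0_lt_compat; lra).
  destruct (Rle_dec r (q / 2)).
  - assert (Q := P r ltac:(lra)). nra.
  - assert (Q := P (q - r) ltac:(lra)).
    replace (PI * ((q - r) / q)) with (PI - PI * (r / q)) in Q by (field; lra).
    rewrite sin_PI_x in Q. nra.
Qed.

(** Bound for a geometric sum of at most [q] terms with ratio [e(m / q)]: the trivial one when the
    ratio is 1, otherwise [2 / |e(m / q) - 1|]. *)
Definition wbound (q m : Z) : R :=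
  if Z.eqb (m mod q) 0 then IZR q else / sin (PI * (IZR (m mod q) / IZR q)).

Lemma sin_ratio_pos (q r : Z) : (0 < r < q)%Z -> 0 < sin (PI * (IZR r / IZR q)).
Proof.
  intros Hr. assert (0 < IZR r) by (apply IZR_lt; lia). assert (IZR r < IZR q) by (apply IZR_lt; lia).
  assert (HP0 := PI_RGT_0).
  assert (0 < IZR r / IZR q) by (apply Rdiv_lt_0_compat; lra).
  assert (IZR r / IZR q < 1). { apply Rmult_lt_reg_r with (IZR q). lra. replace (IZR r / IZR q * IZR q) with (IZR r) by (field; lra). lra. }
  apply sin_gt_0. nra. nra.
Qed.

Lemma wbound_nonneg q m : (0 < q)%Z -> 0 <= wbound q m.
Proof.
  intros Hq. unfold wbound. destruct (Z.eqb_spec (m mod q) 0).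
  - apply IZR_le; lia.
  - left. apply Rinv_0_lt_compat, sin_ratio_pos. generalize (Z.mod_pos_bound m q Hq). lia.
Qed.

Lemma wbound_periodic q m k : (0 < q)%Z -> wbound q (m + k * q) = wbound q m.
Proof. intros Hq. unfold wbound. rewrite Z.mod_add by lia. reflexivity. Qed.

Lemma wbound_mod q m : (0 < q)%Z -> wbound q (m mod q) = wbound q m.
Proof. intros Hq. unfold wbound. rewrite Z.mod_mod by lia. reflexivity. Qed.

Lemma geom_sum_bound q m n : (0 < q)%Z -> (Z.of_nat n <= q)%Z ->
  Cmod (csum (fun k => eZ q (m * Z.of_nat k)) n) <= wbound q m.
Proof.
  intros Hq Hn. unfold wbound. destruct (Z.eqb_spec (m mod q) 0) as [E|E].
  - eapply Rle_trans. apply Cmod_csum.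
    rewrite (rsum_ext _ (fun _ => 1)) by (intros; apply eZ_mod1). rewrite rsum_const, Rmult_1_r, INR_IZR_INZ.
    apply IZR_le; auto.
  - assert (Hr := Z.mod_pos_bound m q Hq). set (r := (m mod q)%Z) in *.
    assert (Hs := sin_ratio_pos q r ltac:(lia)).
    assert (Em : forall k, eZ q (m * k) = eZ q (r * k)).
    { intros k. apply eZ_cong. lia. exists ((m / q) * k)%Z. unfold r. rewrite Z.mod_eq by lia. ring. }
    rewrite (csum_ext _ (fun k => eZ q (r * Z.of_nat k))) by (intros; apply Em).
    assert (G := eZ_geom q r n). apply (f_equal Cmod) in G. rewrite Cmod_mult, eZ_chord in G.
    rewrite Rabs_right in G by lra.
    assert (Cmod (Cminus (eZ q (r * Z.of_nat n)) 1) <= 2).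
    { eapply Rle_trans. apply Cmod_triangle. rewrite Cmod_opp, Cmod_1, eZ_mod1. lra. }
    apply Rmult_le_reg_l with (sin (PI * (IZR r / IZR q))); auto. rewrite Rinv_r by lra. lra.
Qed.

Lemma geom_sum_zero q m : (0 < q)%Z -> ~ (q | m)%Z -> csum (fun k => eZ q (m * Z.of_nat k)) (Z.to_nat q) = RtoC 0.
Proof.
  intros Hq Hd. assert (G := eZ_geom q m (Z.to_nat q)). rewrite Z2Nat.id in G by lia.
  rewrite (eZ_div q (m * q)) in G by (try lia; exists m; ring).
  replace (Cminus 1 1) with (RtoC 0) in G by ring.
  assert (Hr := Z.mod_pos_bound m q Hq).
  assert (Hr0 : (m mod q <> 0)%Z). { intros E. apply Hd. apply Z.mod_divide; auto; lia. }
  assert (Hs := sin_ratio_pos q (m mod q) ltac:(lia)).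
  assert (N : Cminus (eZ q m) 1 <> RtoC 0).
  { rewrite (eZ_cong q m (m mod q)). 2: lia.
    2:{ exists (m / q)%Z. rewrite Z.mod_eq by lia. ring. }
    apply Cmod_gt_0. rewrite eZ_chord, Rabs_right; lra. }
  set (S := csum _ _) in *.
  replace S with (Cmult (Cinv (Cminus (eZ q m) 1)) (Cmult (Cminus (eZ q m) 1) S)).
  - rewrite G. ring.
  - rewrite Cmult_assoc, Cinv_l; auto. ring.
Qed.

(** Each new reciprocal [1 / N] is at most [- ln (1 - 1 / N)], and these logarithms telescope. *)
Lemma harmonic_le n : rsum (fun k => / INR (S k)) n <= 1 + ln (INR (S n)).
Proof.
  destruct n. simpl. rewrite ln_1; lra.
  assert (P : forall n, rsum (fun k => / INR (S k)) (S n) <= 1 + ln (INR (S n))).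
  { clear. induction n. simpl. rewrite ln_1, Rinv_1; lra.
    change (rsum (fun k => / INR (S k)) (S (S n))) with (rsum (fun k => / INR (S k)) (S n) + / INR (S (S n))).
    assert (H1 : 0 < INR (S n)) by (apply lt_0_INR; lia). assert (H2 : INR (S (S n)) = INR (S n) + 1) by apply S_INR.
    assert (/ INR (S (S n)) <= ln (INR (S (S n))) - ln (INR (S n))).
    { rewrite <- ln_div by lra.
      assert (E : INR (S n) / INR (S (S n)) = 1 - / INR (S (S n))) by (rewrite H2; field; lra).
      replace (INR (S (S n)) / INR (S n)) with (/ (INR (S n) / INR (S (S n)))) by (field; lra).
      assert (0 < INR (S n) / INR (S (S n))) by (apply Rdiv_lt_0_compat; lra).
      rewrite ln_Rinv by auto.
      assert (L := exp_ineq1_le (ln (INR (S n) / INR (S (S n))))). rewrite exp_ln in L by auto. lra. }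
    lra. }
  eapply Rle_trans. apply P. apply Rplus_le_compat_l. left. apply ln_increasing.
  apply lt_0_INR; lia. apply lt_INR; lia.
Qed.

(** Residue 0 contributes [q]; the others give [2 q] times two harmonic sums, each at most
    [1 + ln q]. *)
Lemma wbound_sum q : (0 < q)%Z ->
  rsum (fun k => wbound q (Z.of_nat k)) (Z.to_nat q) <= IZR q * (5 + 4 * ln (IZR q)).
Proof.
  intros Hq. set (n := Z.to_nat q). assert (Hn : Z.of_nat n = q) by (apply Z2Nat.id; lia).
  assert (Hn1 : n = (1 + (n - 1))%nat) by lia.
  assert (HqR : IZR q = INR n) by (rewrite INR_IZR_INZ, Hn; auto).
  assert (W0 : rsum (fun k => wbound q (Z.of_nat k)) 1 = IZR q).
  { simpl. unfold wbound. rewrite Z.mod_0_l by lia. simpl. ring. }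
  rewrite Hn1, rsum_add, W0.
  set (f := fun k => / INR (S k)).
  assert (B : rsum (fun k => wbound q (Z.of_nat (1 + k))) (n - 1) <=
     rsum (fun k => 2 * IZR q * (f k + f (n - 1 - 1 - k)%nat)) (n - 1)).
  { apply rsum_le. intros k Hk. unfold wbound. rewrite Z.mod_small by lia.
    destruct (Z.eqb_spec (Z.of_nat (1 + k)) 0). lia.
    unfold f. eapply Rle_trans. apply sin_ratio_lower.
    - split; apply IZR_lt; lia.
    - right. rewrite <- minus_IZR. rewrite !INR_IZR_INZ. do 2 f_equal. do 2 f_equal. lia. }
  rewrite rsum_mult, rsum_plus, rsum_rev in B.
  assert (H := harmonic_le (n - 1)). fold f in H. replace (S (n - 1)) with n in H by lia.
  rewrite <- HqR in H. assert (0 < IZR q) by (apply IZR_lt; lia). nra.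
Qed.

Lemma rsum_double (f : nat -> R) n : (forall k, 0 <= f k) -> rsum (fun k => f (2 * k)%nat) n <= rsum f (2 * n).
Proof.
  intros Hf. induction n. simpl; lra.
  replace (2 * S n)%nat with (S (S (2 * n))) by lia. simpl rsum at 1 2.
  generalize (Hf (S (2 * n))). simpl in *. lra.
Qed.

Lemma rsum_mono (f : nat -> R) m n : (forall k, 0 <= f k) -> (m <= n)%nat -> rsum f m <= rsum f n.
Proof.
  intros Hf Hmn. replace n with (m + (n - m))%nat by lia. rewrite rsum_add.
  assert (0 <= rsum (fun k => f (m + k)%nat) (n - m)) by (apply rsum_nonneg; auto). lra.
Qed.

(** An affine map with slope coprime to [q] permutes the residues: Gauss's lemma gives injectivity,
    and counting does the rest. *)
Lemma rsum_affine_perm (w : Z -> R) q u v : (0 < q)%Z -> Z.gcd u q = 1%Z ->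
  (forall m, w (m mod q)%Z = w m) ->
  rsum (fun h => w (u * Z.of_nat h + v)%Z) (Z.to_nat q) = rsum (fun h => w (Z.of_nat h)) (Z.to_nat q).
Proof.
  intros Hq Hu Hw. set (n := Z.to_nat q).
  rewrite !rsum_list.
  set (s := fun h => Z.to_nat ((u * Z.of_nat h + v) mod q)).
  rewrite (map_ext (fun h => w (u * Z.of_nat h + v)%Z) (fun h => w (Z.of_nat (s h)))).
  2:{ intros h. unfold s. rewrite Z2Nat.id by (apply Z.mod_pos_bound; auto). symmetry; auto. }
  rewrite <- (map_map s (fun h => w (Z.of_nat h))).
  apply fold_Rplus_perm, Permutation_map.
  apply NoDup_Permutation_bis.
  - apply NoDup_map_NoDup_ForallPairs; [|apply seq_NoDup].
    intros h h' Hh Hh' E. apply in_seq in Hh, Hh'. unfold s in E.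
    apply Z2Nat.inj in E; try apply Z.mod_pos_bound; auto.
    assert (D : (q | u * (Z.of_nat h - Z.of_nat h'))%Z).
    { apply Z.cong_iff_0 in E. apply Z.mod_divide in E; [|lia]. replace (u * (Z.of_nat h - Z.of_nat h'))%Z with
        (u * Z.of_nat h + v - (u * Z.of_nat h' + v))%Z by ring. exact E. }
    apply Z.gauss in D. 2: rewrite Z.gcd_comm; auto.
    destruct D as [k Hk]. unfold n in *.
    assert (k = 0)%Z by nia. nia.
  - rewrite length_map, length_seq; auto.
  - intros x Hx. apply in_map_iff in Hx. destruct Hx as [h [<- Hh]]. apply in_seq.
    generalize (Z.mod_pos_bound (u * Z.of_nat h + v) q Hq). unfold s, n. lia.
Qed.

(** Doubling is not injective modulo an even [q]. The even arguments [2 h] are therefore embedded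
    among all integers below [2 q], that is two full periods, whence the extra factor 2. *)
Lemma wbound_twice_sum q u v : (0 < q)%Z -> Z.gcd u q = 1%Z ->
  rsum (fun h => wbound q (2 * (u * Z.of_nat h + v))) (Z.to_nat q) <= 2 * (IZR q * (5 + 4 * ln (IZR q))).
Proof.
  intros Hq Hu.
  rewrite (rsum_affine_perm (fun m => wbound q (2 * m)) q u v Hq Hu).
  2:{ intros m. rewrite <- (wbound_mod q (2 * m)), <- (wbound_mod q (2 * (m mod q))) by auto.
      rewrite Z.mul_mod_idemp_r by lia. reflexivity. }
  assert (Hn : forall k, 0 <= wbound q (Z.of_nat k)) by (intros; apply wbound_nonneg; auto).
  rewrite (rsum_ext _ (fun h => wbound q (Z.of_nat (2 * h)))).
  2:{ intros. f_equal. lia. }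
  eapply Rle_trans. apply (rsum_double (fun k => wbound q (Z.of_nat k))); auto.
  replace (2 * Z.to_nat q)%nat with (Z.to_nat q + Z.to_nat q)%nat by lia. rewrite rsum_add.
  rewrite (rsum_ext (fun k => wbound q (Z.of_nat (Z.to_nat q + k))) (fun k => wbound q (Z.of_nat k))).
  2:{ intros k _. rewrite <- (wbound_periodic q (Z.of_nat k) 1) by auto. f_equal. lia. }
  generalize (wbound_sum q Hq). lra.
Qed.

(** * Quadratic exponential sums, incomplete and complete *)

Definition quad (P b k : Z) : Z := (- P * k * k + b * k)%Z.
(** The offset [A] is the first frequency of the block. The bounds below are uniform in it. *)
Definition qterm (q P b A : Z) (k : nat) : C := eZ q (quad P b (A + Z.of_nat k)).

Lemma qterm_mod q P b A k : Cmod (qterm q P b A k) = 1.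
Proof. apply eZ_mod1. Qed.

(** Differencing removes the square of [k]: for fixed lag [h] only a geometric progression of ratio
    [e(- 2 P h / q)] remains, up to a unimodular constant. *)
Lemma qterm_corr q P b A k h :
  Cmult (qterm q P b A (k + h)) (Cconj (qterm q P b A k)) =
  Cmult (eZ q (- P * (2 * A * Z.of_nat h + Z.of_nat h * Z.of_nat h) + b * Z.of_nat h))
    (eZ q ((2 * (- P * Z.of_nat h)) * Z.of_nat k)).
Proof.
  unfold qterm. rewrite eZ_conj, <- !eZ_add. f_equal. unfold quad. rewrite Nat2Z.inj_add. ring.
Qed.

(** The diagonal gives [n <= q] and the correlations [2 * 2 * q (5 + 4 ln q)], in all
    [q (21 + 16 ln q)]. *)
Lemma qsum_weyl q P b A n : (0 < q)%Z -> Z.gcd P q = 1%Z -> (Z.of_nat n <= q)%Z ->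
  Cmod (csum (qterm q P b A) n) ^ 2 <= 21 * (IZR q * (1 + ln (IZR q))).
Proof.
  intros Hq HP Hn.
  eapply Rle_trans. apply weyl_differencing.
  rewrite (rsum_ext (fun k => Cmod (qterm q P b A k) ^ 2) (fun _ => 1)).
  2:{ intros. rewrite qterm_mod. ring. }
  rewrite rsum_const.
  assert (B : rsum (fun h => Cmod (csum (fun k => Cmult (qterm q P b A (k + h + 1)) (Cconj (qterm q P b A k))) (n - 1 - h))) n
     <= 2 * (IZR q * (5 + 4 * ln (IZR q)))).
  { eapply Rle_trans; [|apply (wbound_twice_sum q (- P) (- P)); auto; rewrite Z.gcd_opp_l; auto].
    eapply Rle_trans; [apply rsum_le | apply rsum_mono].
    - intros h Hh.
      rewrite (csum_ext _ (fun k => Cmult (eZ q (- P * (2 * A * Z.of_nat (h + 1) + Z.of_nat (h + 1) * Z.of_nat (h + 1)) + b * Z.of_nat (h + 1)))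
         (eZ q ((2 * (- P * Z.of_nat (h + 1))) * Z.of_nat k)))).
      2:{ intros k _. rewrite <- Nat.add_assoc. apply qterm_corr. }
      rewrite csum_mult, Cmod_mult, eZ_mod1, Rmult_1_l.
      (* The lag is [h + 1], so the affine map has slope and intercept both equal to [- P]. *)
      replace (2 * (- P * Z.of_nat h + - P))%Z with (2 * (- P * Z.of_nat (h + 1)))%Z by lia.
      apply geom_sum_bound; auto. lia.
    - intros; apply wbound_nonneg; auto.
    - lia. }
  assert (INR n <= IZR q) by (rewrite INR_IZR_INZ; apply IZR_le; auto).
  assert (1 <= IZR q) by (apply IZR_le; lia).
  assert (0 <= ln (IZR q)). { rewrite <- ln_1. destruct H0. left; apply ln_increasing; lra. rewrite <- H0; lra. }
  nra.
Qed.

Definition parity_ok (q b : Z) : Prop :=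
  ((q mod 4 = 0)%Z -> Z.even b = true) /\ ((q mod 4 = 2)%Z -> Z.odd b = true).

Lemma qterm_periodic q P b A k : (0 < q)%Z -> qterm q P b A (k + Z.to_nat q) = qterm q P b A k.
Proof.
  intros Hq. unfold qterm. apply eZ_cong. lia.
  rewrite Nat2Z.inj_add, Z2Nat.id by lia. unfold quad.
  exists (- P * (2 * (A + Z.of_nat k) + q) + b)%Z. ring.
Qed.

Lemma csum_cyclic (a : nat -> C) n k : (forall j, a (j + n)%nat = a j) ->
  csum (fun h => a (k + h)%nat) n = csum a n.
Proof.
  intros Ha. induction k. reflexivity.
  rewrite <- IHk.
  assert (E := csum_add (fun h => a (k + h)%nat) 1 n).
  change (Cplus (csum (fun h => a (k + h)%nat) n) (a (k + n)%nat) =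
    Cplus (csum (fun h => a (k + h)%nat) 1) (csum (fun h => a (k + (1 + h))%nat) n)) in E.
  rewrite Ha in E. simpl csum at 2 in E. rewrite Nat.add_0_r in E.
  rewrite (csum_ext _ (fun h => a (k + (1 + h))%nat)).
  2:{ intros; f_equal; lia. }
  match goal with |- ?u = ?v => replace u with (Cminus (Cplus (Cplus 0 (a k)) u) (a k)) by ring end.
  rewrite <- E. ring.
Qed.

(** Over a full period the correlations become complete sums, which can be evaluated exactly,
    whereas Weyl differencing only bounds incomplete ones. *)
Lemma csum_cyclic_norm2 (a : nat -> C) n : (forall j, a (j + n)%nat = a j) ->
  Cmult (csum a n) (Cconj (csum a n)) = csum (fun h => csum (fun k => Cmult (a (k + h)%nat) (Cconj (a k))) n) n.
Proof.
  intros Ha. rewrite csum_swap, csum_conj, <- csum_mult.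
  apply csum_ext. intros k _.
  rewrite <- (csum_cyclic a n k Ha), Cmult_comm, <- csum_mult. apply csum_ext. intros; ring.
Qed.

Lemma rsum_ind j c n : rsum (fun h => if Nat.eqb h j then c else 0) n = if Nat.ltb j n then c else 0.
Proof.
  induction n; auto. simpl rsum. rewrite IHn.
  destruct (Nat.eqb_spec n j), (Nat.ltb_spec j n), (Nat.ltb_spec j (S n)); try lia; try lra.
Qed.

Lemma fst_csum f n : fst (csum f n) = rsum (fun k => fst (f k)) n.
Proof. induction n; simpl; auto. rewrite IHn; auto. Qed.

(* For h = q/2 the parity condition makes the phase of the second surviving term equal to 1. *)
Lemma half_period_phase q P b A h : (0 < q)%Z -> Z.gcd P q = 1%Z -> parity_ok q b -> (2 * h = q)%Z ->
  (q | - P * (2 * A * h + h * h) + b * h)%Z.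
Proof.
  intros Hq HP [H0 H2] Hh.
  assert (E : Z.even (b - P * h) = true).
  { rewrite Z.even_sub, Z.even_mul.
    destruct (Z.even h) eqn:Eh.
    - rewrite H0. destruct (Z.even P); auto.
      apply Z.even_spec in Eh. destruct Eh as [m Hm]. subst. replace (2 * (2 * m))%Z with (m * 4)%Z by ring. apply Z.mod_mul; lia.
    - assert (Eo : Z.odd h = true) by (rewrite <- Z.negb_even, Eh; auto).
      apply Z.odd_spec in Eo. destruct Eo as [m Hm].
      assert (Hb : Z.odd b = true).
      { apply H2. subst. replace (2 * (2 * m + 1))%Z with (2 + m * 4)%Z by ring. rewrite Z.mod_add by lia. reflexivity. }
      rewrite <- Z.negb_odd, Hb. simpl.
      destruct (Z.even P) eqn:EP; auto.
      apply Z.even_spec in EP. destruct EP as [p Hp].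
      exfalso. assert (D : (2 | Z.gcd P q)%Z). { apply Z.gcd_greatest; [exists p | exists h]; lia. }
      rewrite HP in D. apply Z.divide_1_r_nonneg in D; lia. }
  apply Z.even_spec in E. destruct E as [m Hm].
  exists (- P * A + m)%Z.
  transitivity (- P * A * (2 * h) + h * (b - P * h))%Z. ring. rewrite Hm, <- Hh. ring.
Qed.

(** The squared modulus is the sum of all cyclic correlations. That of lag [h] vanishes unless [q]
    divides [2 h], so only [h = 0] and possibly [h = q / 2] survive. Parity makes the second
    contribution [+ q]; with the wrong parity it would cancel the first. *)
Lemma gauss_sum_norm2 q P b A : (0 < q)%Z -> Z.gcd P q = 1%Z -> parity_ok q b ->
  IZR q <= Cmod (csum (qterm q P b A) (Z.to_nat q)) ^ 2 <= 2 * IZR q.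
Proof.
  intros Hq HP Hb. set (n := Z.to_nat q). assert (Hn : Z.of_nat n = q) by (apply Z2Nat.id; lia).
  assert (Hq0 : 0 < IZR q) by (apply IZR_lt; lia).
  set (G := csum (qterm q P b A) n).
  set (t := fun h => if Nat.eqb h 0 then IZR q else if Nat.eqb (2 * h) n then IZR q else 0).
  assert (E : Cmod G ^ 2 = rsum t n).
  { transitivity (fst (Cmult G (Cconj G))). { rewrite <- Cmod2_conj. reflexivity. }
    unfold G. rewrite csum_cyclic_norm2 by (intros; apply qterm_periodic; auto).
    rewrite fst_csum. apply rsum_ext. intros h Hh.
    rewrite (csum_ext _ _ n (fun k _ => qterm_corr q P b A k h)), csum_mult.
    set (ph := (- P * (2 * A * Z.of_nat h + Z.of_nat h * Z.of_nat h) + b * Z.of_nat h)%Z).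
    assert (Full : (q | 2 * (- P * Z.of_nat h))%Z -> (q | ph)%Z ->
       fst (Cmult (eZ q ph) (csum (fun k => eZ q (2 * (- P * Z.of_nat h) * Z.of_nat k)) n)) = IZR q).
    { intros D1 D2. rewrite (eZ_div q ph) by (auto; lia).
      rewrite (csum_ext _ (fun _ => RtoC 1)).
      2:{ intros k _. apply eZ_div. lia. apply Z.divide_mul_l; auto. }
      rewrite Cmult_1_l, fst_csum. simpl. rewrite rsum_const, INR_IZR_INZ, Hn. ring. }
    unfold t. destruct (Nat.eqb_spec h 0) as [->|Hh0].
    - apply Full.
      + exists 0%Z. lia.
      + exists 0%Z. unfold ph. simpl Z.of_nat. ring.
    - destruct (Nat.eqb_spec (2 * h) n) as [Hh2|Hh2].
      + apply Full.
        * exists (- P)%Z. rewrite <- Hn. lia.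
        * apply half_period_phase; auto. lia.
      + unfold n. rewrite geom_sum_zero; auto. { simpl; ring. }
        intros D. replace (2 * (- P * Z.of_nat h))%Z with (P * (- (2 * Z.of_nat h)))%Z in D by ring.
        apply Z.gauss in D. 2: rewrite Z.gcd_comm; auto.
        (* As [0 < 2 h < 2 q], divisibility by [q] would force [2 h = q], a case already
           excluded. *)
        destruct D as [k Hk]. assert (k = -1)%Z by nia. lia. }
  rewrite E. split.
  - apply Rle_trans with (rsum (fun h => if Nat.eqb h 0 then IZR q else 0) n).
    + rewrite rsum_ind. destruct (Nat.ltb_spec 0 n). lra. lia.
    + apply rsum_le. intros h _. unfold t. destruct (Nat.eqb h 0). lra. destruct (Nat.eqb (2 * h) n); lra.
  (* For odd [n] the indicator of [n / 2] overcounts, which is harmless in an upper bound. *)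
  - apply Rle_trans with (rsum (fun h => (if Nat.eqb h 0 then IZR q else 0) + (if Nat.eqb h (n / 2) then IZR q else 0)) n).
    + apply rsum_le. intros h _. unfold t. destruct (Nat.eqb_spec h 0). { destruct (Nat.eqb h (n / 2)); lra. }
      destruct (Nat.eqb_spec (2 * h) n) as [<-|]. { rewrite Nat.mul_comm, Nat.div_mul, Nat.eqb_refl by lia. lra. }
      destruct (Nat.eqb h (n / 2)); lra.
    + rewrite rsum_plus, !rsum_ind. destruct (Nat.ltb 0 n), (Nat.ltb (n / 2) n); lra.
Qed.

Lemma qsum_decomp q P b A M : (0 < q)%Z ->
  let n := Z.to_nat q in
  csum (qterm q P b A) M = Cplus (Cmult (RtoC (INR (M / n))) (csum (qterm q P b A) n))
    (csum (qterm q P b A) (M mod n)).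
Proof.
  intros Hq n.
  assert (Hp : forall j, qterm q P b A (j + n) = qterm q P b A j) by (intros; apply qterm_periodic; auto).
  assert (Q : forall m r, csum (qterm q P b A) (m * n + r) = Cplus (Cmult (RtoC (INR m)) (csum (qterm q P b A) n)) (csum (qterm q P b A) r)).
  { induction m; intros r. { simpl. ring. }
    replace (S m * n + r)%nat with (n + (m * n + r))%nat by lia. rewrite csum_add.
    rewrite (csum_ext (fun k => qterm q P b A (n + k)%nat) (qterm q P b A)).
    2:{ intros k _. rewrite Nat.add_comm. apply Hp. }
    rewrite IHm, S_INR, RtoC_plus. ring. }
  rewrite <- Q. f_equal. rewrite Nat.mul_comm. apply Nat.div_mod. unfold n; lia.
Qed.

(** The number of complete periods lies between [M / q - 1] and [M / q], each period having modulus
    between [sqrt q] and [2 sqrt q]. The remainder fits into [e] because [21 <= 5 ^ 2]. *)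
Lemma qsum_bounds q P b A M : (0 < q)%Z -> Z.gcd P q = 1%Z -> parity_ok q b ->
  let e := 5 * (sqrt (IZR q) * sqrt (1 + ln (IZR q))) in
  (INR M / IZR q - 1) * sqrt (IZR q) - e <= Cmod (csum (qterm q P b A) M) <= 2 * (INR M / IZR q) * sqrt (IZR q) + e.
Proof.
  intros Hq HP Hb e.
  assert (Hq1 : 1 <= IZR q) by (apply IZR_le; lia).
  assert (Hln : 0 <= ln (IZR q)). { rewrite <- ln_1. destruct Hq1. left; apply ln_increasing; lra. rewrite <- H; lra. }
  assert (D := qsum_decomp q P b A M Hq). cbv zeta in D. rewrite D.
  set (n := Z.to_nat q) in *. assert (Hn : Z.of_nat n = q) by (apply Z2Nat.id; lia).
  assert (HnR : INR n = IZR q) by (rewrite INR_IZR_INZ, Hn; auto).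
  set (G := csum (qterm q P b A) n). set (T := csum (qterm q P b A) (M mod n)).
  assert (HG := gauss_sum_norm2 q P b A Hq HP Hb). fold n G in HG.
  assert (HT : Cmod T ^ 2 <= 21 * (IZR q * (1 + ln (IZR q)))).
  { apply qsum_weyl; auto. generalize (Nat.mod_upper_bound M n). lia. }
  assert (HT' : Cmod T <= e).
  { unfold e. rewrite <- sqrt_mult by lra.
    apply Rsqr_incr_0_var. 2:{ generalize (sqrt_pos (IZR q * (1 + ln (IZR q)))); lra. }
    rewrite !Rsqr_pow2, Rpow_mult_distr, pow2_sqrt by nra. nra. }
  assert (Hs0 := sqrt_pos (IZR q)). assert (Hs2 := sqrt_sqrt (IZR q) ltac:(lra)).
  assert (HG1 : sqrt (IZR q) <= Cmod G).
  { apply Rsqr_incr_0_var; [|apply Cmod_ge_0]. unfold Rsqr. rewrite Hs2. lra. }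
  assert (HG2 : Cmod G <= 2 * sqrt (IZR q)).
  { apply Rsqr_incr_0_var; [|lra]. unfold Rsqr. nra. }
  assert (Hm : INR M / IZR q - 1 <= INR (M / n) <= INR M / IZR q).
  { assert (E : INR M = IZR q * INR (M / n) + INR (M mod n)).
    { rewrite <- HnR, <- mult_INR, <- plus_INR. f_equal. apply Nat.div_mod. lia. }
    assert (0 <= INR (M mod n)) by apply pos_INR.
    assert (INR (M mod n) < IZR q). { rewrite <- HnR. apply lt_INR. apply Nat.mod_upper_bound. lia. }
    rewrite E. split; apply Rmult_le_reg_r with (IZR q); try lra.
    - replace (((IZR q * INR (M / n) + INR (M mod n)) / IZR q - 1) * IZR q) with (IZR q * INR (M / n) + INR (M mod n) - IZR q) by (field; lra). nra.
    - replace ((IZR q * INR (M / n) + INR (M mod n)) / IZR q * IZR q) with (IZR q * INR (M / n) + INR (M mod n)) by (field; lra). nra. }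
  assert (Hm0 := pos_INR (M / n)).
  assert (Emod : Cmod (Cmult (RtoC (INR (M / n))) G) = INR (M / n) * Cmod G).
  { rewrite Cmod_mult, Cmod_R, Rabs_right; auto. lra. }
  split.
  - assert (Tr := Cmod_triangle (Cplus (Cmult (RtoC (INR (M / n))) G) T) (Copp T)).
    replace (Cplus (Cplus (Cmult (RtoC (INR (M / n))) G) T) (Copp T)) with (Cmult (RtoC (INR (M / n))) G) in Tr by ring.
    rewrite Cmod_opp, Emod in Tr. nra.
  - eapply Rle_trans. apply Cmod_triangle. rewrite Emod. nra.
Qed.

(** * Factorization over the coordinates *)

Lemma abel_summation (a v : nat -> C) M :
  csum (fun k => Cmult (a k) (v k)) M =
  Cminus (Cmult (csum a M) (v M)) (csum (fun k => Cmult (csum a (S k)) (Cminus (v (S k)) (v k))) M).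
Proof. induction M; simpl in *. ring. rewrite IHM. ring. Qed.

(** Only the last weight has to be close to 1. The others enter through their increments, each
    multiplied by a partial sum bounded by [U]. *)
Lemma abel_lower (a v : nat -> C) M Lo U d e :
  0 <= U -> Lo <= Cmod (csum a M) -> (forall k, (k <= M)%nat -> Cmod (csum a k) <= U) ->
  (forall k, (k < M)%nat -> Cmod (Cminus (v (S k)) (v k)) <= d) -> Cmod (Cminus (v M) 1) <= e ->
  Lo - U * e - INR M * (U * d) <= Cmod (csum (fun k => Cmult (a k) (v k)) M).
Proof.
  intros HU HL HB Hd He. rewrite abel_summation.
  set (E := csum (fun k => Cmult (csum a (S k)) (Cminus (v (S k)) (v k))) M).
  assert (HE : Cmod E <= INR M * (U * d)).
  { eapply Rle_trans. apply Cmod_csum. rewrite <- rsum_const. apply rsum_le. intros k Hk.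
    rewrite Cmod_mult. apply Rmult_le_compat; try apply Cmod_ge_0; auto. }
  assert (T : Cmod (csum a M) <= Cmod (Cminus (Cmult (csum a M) (v M)) E) + (Cmod (Cmult (csum a M) (Cminus (v M) 1)) + Cmod E)).
  { replace (csum a M) with (Cplus (Cminus (Cmult (csum a M) (v M)) E) (Cplus (Copp (Cmult (csum a M) (Cminus (v M) 1))) E)) at 1 by ring.
    eapply Rle_trans. apply Cmod_triangle. apply Rplus_le_compat_l.
    eapply Rle_trans. apply Cmod_triangle. rewrite Cmod_opp. lra. }
  rewrite Cmod_mult in T.
  assert (Cmod (csum a M) * Cmod (Cminus (v M) 1) <= U * e).
  { apply Rmult_le_compat; try apply Cmod_ge_0; auto. }
  lra.
Qed.

Lemma csum_list f n : csum f n = fold_right Cplus (RtoC 0) (map f (seq 0 n)).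
Proof.
  assert (P : forall l x, fold_right Cplus (RtoC 0) (l ++ x :: nil) = Cplus (fold_right Cplus (RtoC 0) l) x).
  { induction l; intros; simpl. ring. rewrite IHl; ring. }
  induction n; auto. rewrite seq_S, map_app. simpl map. rewrite P, <- IHn. reflexivity.
Qed.

Lemma csum_zero f n : (forall k, (k < n)%nat -> f k = RtoC 0) -> csum f n = RtoC 0.
Proof. induction n; simpl; intros H; auto. rewrite IHn, (H n) by auto. ring. Qed.

Lemma Zsum_open_csum a b : 0 <= a -> a + 1 <= b ->
  exists A M : nat, a < INR A /\ INR (A + M) <= b + 1 /\ b - a - 1 <= INR M <= b - a + 1 /\
    forall g, Zsum_open a b g = csum (fun k => g (Z.of_nat (A + k))) M.
Proof.
  intros Ha Hab.
  destruct (archimed a) as [A1 A2]. destruct (archimed b) as [B1 B2]. destruct (archimed (- b)) as [C1 C2].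
  (* [up a] is the least integer above [a], and [1 - up (- b)] is the ceiling of [b]: the integers
     strictly between [a] and [b] are those from [A] to [E - 1]. The hypothesis [a + 1 <= b] ensures
     [A <= E]. *)
  set (A := Z.to_nat (up a)). set (E := Z.to_nat (1 - up (- b))). set (N := Z.to_nat (up b)).
  assert (HA : INR A = IZR (up a)).
  { unfold A. rewrite INR_IZR_INZ, Z2Nat.id; auto. apply le_IZR. lra. }
  assert (HN : INR N = IZR (up b)).
  { unfold N. rewrite INR_IZR_INZ, Z2Nat.id; auto. apply le_IZR. lra. }
  assert (HE : INR E = 1 - IZR (up (- b))).
  { unfold E. rewrite INR_IZR_INZ, Z2Nat.id. apply minus_IZR. apply le_IZR. rewrite minus_IZR. lra. }
  assert (HAE : (A <= E)%nat). { apply INR_le. lra. }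
  assert (HEN : (E <= N)%nat). { assert (E < S N)%nat; [|lia]. apply INR_lt. rewrite S_INR. lra. }
  exists A, (E - A)%nat.
  replace (A + (E - A))%nat with E by lia. rewrite minus_INR by auto.
  repeat split; try lra.
  intros g. unfold Zsum_open. rewrite <- csum_list. fold N.
  set (F := fun k => _).
  replace N with (A + ((E - A) + (N - E)))%nat by lia. rewrite !csum_add.
  rewrite (csum_zero F A).
  2:{ intros k Hk. unfold F. destruct (Rlt_dec a (IZR (Z.of_nat k))); auto.
      exfalso. assert (Z.of_nat k < up a)%Z by (unfold A in *; lia).
      assert (IZR (Z.of_nat k) <= IZR (up a - 1)) by (apply IZR_le; lia). rewrite minus_IZR in H0. lra. }
  rewrite (csum_zero _ (N - E)).
  2:{ intros k Hk. unfold F. destruct (Rlt_dec a (IZR _)); auto. destruct (Rlt_dec (IZR _) b); auto.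
      exfalso. rewrite <- INR_IZR_INZ, !plus_INR, minus_INR in r0 by auto. generalize (pos_INR k). lra. }
  rewrite (csum_ext _ (fun k => g (Z.of_nat (A + k)))). { ring. }
  intros k Hk. unfold F. rewrite <- INR_IZR_INZ, plus_INR. generalize (pos_INR k). intros.
  destruct (Rlt_dec a (INR A + INR k)); [|lra].
  destruct (Rlt_dec (INR A + INR k) b); auto. exfalso.
  assert (INR A + INR k + 1 <= INR E). { rewrite <- plus_INR, <- S_INR. apply le_INR. lia. } lra.
Qed.

Lemma lineint_csum (f : nat -> R -> C) (I : nat -> C) n : (forall k, (k < n)%nat -> lineint (f k) (I k)) ->
  lineint (fun s => csum (fun k => f k s) n) (csum I n).
Proof.
  induction n; intros H; simpl. apply lineint_0.
  apply lineint_plus; auto.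
Qed.

Lemma Cprod_ext f g k : (forall j, (j < k)%nat -> f j = g j) -> Cprod_upto f k = Cprod_upto g k.
Proof. induction k; simpl; intros H; auto. rewrite IHk, (H k); auto. Qed.

Lemma Cprod_mult f g k : Cprod_upto (fun j => Cmult (f j) (g j)) k = Cmult (Cprod_upto f k) (Cprod_upto g k).
Proof. induction k; simpl. ring. rewrite IHk; ring. Qed.

Lemma Cprod_S f k : Cprod_upto f (S k) = Cmult (f 0%nat) (Cprod_upto (fun j => f (S j)) k).
Proof. induction k. simpl; ring. simpl in *. rewrite IHk. ring. Qed.

Lemma expi_dot k n x y : expi (k * dotn n x y) = Cprod_upto (fun j => expi (k * (x j * y j))) n.
Proof.
  induction n; simpl. rewrite Rmult_0_r, expi_0; auto.
  rewrite Rmult_plus_distr_l, expi_plus, IHn. reflexivity.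
Qed.

Lemma iint_prod k (g : nat -> R -> C) (I : nat -> C) : (forall j, (j < k)%nat -> lineint (g j) (I j)) ->
  forall F a y, (forall x, (forall j, (k <= j)%nat -> x j = y j) -> F x = Cmult a (Cprod_upto (fun j => g j (x j)) k)) ->
  iint k F y = Cmult a (Cprod_upto I k).
Proof.
  induction k; intros Hg F a y HF.
  - simpl. rewrite (HF y); auto.
  - simpl. apply lineint_unique.
    apply lineint_ext with (f := fun s => Cmult (Cmult a (Cprod_upto I k)) (g k s)).
    + intros s. symmetry. transitivity (Cmult (Cmult a (g k s)) (Cprod_upto I k)); [|ring].
      apply IHk. { auto. }
      intros x Hx. rewrite HF.
      * simpl. rewrite (Hx k) by auto. unfold upd at 1. rewrite Nat.eqb_refl. ring.
      * intros j Hj. rewrite Hx by lia. unfold upd. destruct (Nat.eqb_spec j k); auto. lia.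
    + rewrite Cmult_assoc. apply lineint_mult. auto.
Qed.

Lemma integral_Rn_prod n F (g : nat -> R -> C) (I : nat -> C) :
  (forall x, F x = Cprod_upto (fun j => g j (x j)) n) -> (forall j, (j < n)%nat -> lineint (g j) (I j)) ->
  integral_Rn n F = Cprod_upto I n.
Proof.
  intros HF Hg. unfold integral_Rn. rewrite (iint_prod n g I Hg F (RtoC 1)). ring.
  intros x _. rewrite HF; ring.
Qed.

Lemma schrod_prod n t f x (g : nat -> R -> C) (h : nat -> R -> C) (J : nat -> C) :
  (forall x, f x = Cprod_upto (fun j => g j (x j)) n) ->
  (forall j, (j < n)%nat -> forall k, lineint (fun s => Cmult (g j s) (expi (- 2 * PI * (s * k)))) (h j k)) ->
  (forall j, (j < n)%nat -> lineint (fun k => Cmult (h j k) (expi (- PI * t * k ^ 2 + 2 * PI * (x j * k)))) (J j)) ->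
  schrod n t f x = Cprod_upto J n.
Proof.
  intros Hf Hh HJ. unfold schrod.
  apply integral_Rn_prod with (g := fun j k => Cmult (h j k) (expi (- PI * t * k ^ 2 + 2 * PI * (x j * k)))); auto.
  intros xi. rewrite expi_plus, !expi_dot.
  unfold fourier.
  rewrite (integral_Rn_prod n _ (fun j s => Cmult (g j s) (expi (- 2 * PI * (s * xi j)))) (fun j => h j (xi j))).
  - rewrite <- !Cprod_mult. apply Cprod_ext. intros j _. rewrite expi_plus. do 4 f_equal. ring.
  - intros y. rewrite Hf, expi_dot, <- Cprod_mult. reflexivity.
  - auto.
Qed.

(** * One-dimensional evolution of modulated and dilated profiles *)

Lemma hat_gabor phi s m k : phi_hyp phi -> 0 < s ->
  lineint (fun y => Cmult (Cmult (expi (2 * PI * (m * y))) (RtoC (phi (s * y)))) (expi (- 2 * PI * (y * k))))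
    (Cmult (RtoC (/ s)) (fourier1 phi ((k - m) / s))).
Proof.
  intros H Hs.
  apply lineint_ext with (f := fun y => wave phi ((m - k) / s) (s * y + 0)).
  - intros y. unfold wave. rewrite Rplus_0_r.
    replace (2 * PI * (s * y * ((m - k) / s))) with (2 * PI * (m * y) + - 2 * PI * (y * k)) by (field; lra).
    rewrite expi_plus. ring.
  - apply lineint_comp_lin; auto. apply wave_ccont; auto.
    replace ((k - m) / s) with (- ((m - k) / s)) by (field; lra). apply hat_lineint; auto.
Qed.

Lemma chirp_cont t x s m : forall y, continuous (fun y => - PI * t * (s * y + m) ^ 2 + 2 * PI * (x * (s * y + m))) y.
Proof. cont_auto. Qed.

(** Substituting [k = s y + m] moves the support to [[-1, 1]], and the Jacobian cancels the factor
    [/ s]. *)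
Lemma hat_gabor_schrod phi s m t x : phi_hyp phi -> 0 < s ->
  lineint (fun k => Cmult (Cmult (RtoC (/ s)) (fourier1 phi ((k - m) / s))) (expi (- PI * t * k ^ 2 + 2 * PI * (x * k))))
   (CI (fun y => Cmult (fourier1 phi y) (expi (- PI * t * (s * y + m) ^ 2 + 2 * PI * (x * (s * y + m))))) (-1) 1).
Proof.
  intros H Hs.
  set (F0 := fun y => Cmult (fourier1 phi y) (expi (- PI * t * (s * y + m) ^ 2 + 2 * PI * (x * (s * y + m))))).
  assert (HF : ccont F0). { apply ccont_mult. apply hat_ccont; auto. apply ccont_expi, chirp_cont. }
  assert (HL : lineint F0 (CI F0 (-1) 1)).
  { apply lineint_compact; auto. lra. intros y Hy. unfold F0. rewrite hat_supp; auto. ring.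
    destruct Hy; [rewrite Rabs_left | rewrite Rabs_right]; lra. }
  assert (Hs' := Rinv_0_lt_compat s Hs).
  assert (L := lineint_mult (RtoC (/ s)) _ _ (lineint_comp_lin F0 _ (/ s) (- (m / s)) Hs' HF HL)).
  rewrite Cmult_assoc, <- RtoC_mult, Rinv_inv, Rinv_l, Cmult_1_l in L by lra.
  revert L. apply lineint_ext. intros k. unfold F0.
  replace (/ s * k + - (m / s)) with ((k - m) / s) by (field; lra).
  replace (s * ((k - m) / s) + m) with k by (field; lra). ring.
Qed.

Lemma hat_osc phi th1 th2 e : phi_hyp phi -> (forall y, continuous th1 y) -> (forall y, continuous th2 y) ->
  (forall y, -1 <= y <= 1 -> Rabs (th1 y - th2 y) <= e) ->
  Cmod (Cminus (CI (fun y => Cmult (fourier1 phi y) (expi (th1 y))) (-1) 1)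
               (CI (fun y => Cmult (fourier1 phi y) (expi (th2 y))) (-1) 1)) <= 2 * mass phi * e.
Proof.
  intros H H1 H2 He. replace (2 * mass phi * e) with ((1 - -1) * (mass phi * e)) by ring.
  apply CI_lip_expi; auto. lra. apply hat_ccont; auto. intros; apply hat_le_mass; auto.
Qed.

(** The reference value 1 is inversion at the origin, where [phi 0 = 1]. *)
Lemma hat_osc_1 phi th e : phi_hyp phi -> (forall y, continuous th y) ->
  (forall y, -1 <= y <= 1 -> Rabs (th y) <= e) ->
  Cmod (Cminus (CI (fun y => Cmult (fourier1 phi y) (expi (th y))) (-1) 1) 1) <= 2 * mass phi * e.
Proof.
  intros H H1 He.
  assert (E : CI (fun y => Cmult (fourier1 phi y) (expi (2 * PI * (0 * y)))) (-1) 1 = RtoC 1).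
  { rewrite fourier_inversion; auto. f_equal. apply H. }
  rewrite <- E. apply hat_osc; auto. cont_auto.
  intros y Hy. rewrite Rmult_0_l, Rmult_0_r, Rminus_0_r. auto.
Qed.

Lemma CI_expi_shift g th a k u v : ccont g -> (forall y, continuous th y) ->
  (forall y, a y = k + th y) ->
  CI (fun y => Cmult (g y) (expi (a y))) u v = Cmult (expi k) (CI (fun y => Cmult (g y) (expi (th y))) u v).
Proof.
  intros Hg Hth E. rewrite <- CI_mult.
  - apply CI_ext. intros y _. rewrite E, expi_plus. ring.
  - apply ccont_mult; auto. apply ccont_expi; auto.
Qed.

Lemma Rabs_mult_le a b A B : Rabs a <= A -> Rabs b <= B -> Rabs (a * b) <= A * B.
Proof. intros. rewrite Rabs_mult. apply Rmult_le_compat; auto using Rabs_pos. Qed.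

(** Since [x] is centred at [t Rp], the point reached by frequency [Rp] at time [t], the terms
    linear in [y] nearly cancel. With [PI <= 4] the quadratic remainder is at most [4 c] and the
    linear one [8 c], so the integral differs from 1 in modulus by at most [24 * mass phi * c], far
    below 1/2. *)
Lemma first_factor_lower phi Rp t x c : phi_hyp phi -> 1 <= Rp -> 0 < t ->
  4000 * mass phi * c <= 1 -> t * Rp <= c -> Rabs (x - t * Rp) <= c / sqrt Rp ->
  1 / 2 <= Cmod (CI (fun y => Cmult (fourier1 phi y) (expi (- PI * t * (sqrt Rp * y + Rp) ^ 2 + 2 * PI * (x * (sqrt Rp * y + Rp))))) (-1) 1).
Proof.
  intros H HR Ht Hc HtR Hx.
  assert (HP := PI_RGT_0). assert (HP4 := PI_4). assert (Hm := mass_pos phi H).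
  assert (Hs0 : 0 < sqrt Rp) by (apply sqrt_lt_R0; lra). assert (Hs := sqrt_sqrt Rp ltac:(lra)).
  set (th := fun y => - PI * (t * Rp) * y ^ 2 + 2 * PI * (sqrt Rp * (x - t * Rp)) * y).
  rewrite (CI_expi_shift (fourier1 phi) th _ (- PI * t * Rp ^ 2 + 2 * PI * x * Rp)).
  2:{ apply hat_ccont; auto. }
  2:{ unfold th. cont_auto. }
  2:{ intros y. unfold th.
      replace (- PI * t * (sqrt Rp * y + Rp) ^ 2) with (- PI * t * ((sqrt Rp * sqrt Rp) * y ^ 2 + 2 * sqrt Rp * Rp * y + Rp ^ 2)) by ring.
      rewrite Hs. ring. }
  rewrite Cmod_mult, Cmod_expi, Rmult_1_l.
  assert (B : forall y, -1 <= y <= 1 -> Rabs (th y) <= 12 * c).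
  { intros y Hy. unfold th. eapply Rle_trans. apply Rabs_triang.
    assert (Ry : Rabs y <= 1) by (apply Rabs_le; lra).
    assert (B1 : Rabs (- PI * (t * Rp) * y ^ 2) <= 4 * c * 1).
    { apply Rabs_mult_le. 2:{ rewrite <- RPow_abs. simpl. generalize (Rabs_pos y). nra. }
      apply Rabs_mult_le. rewrite Rabs_Ropp, Rabs_right; lra. rewrite Rabs_right; [auto | apply Rle_ge; nra]. }
    assert (B2 : Rabs (2 * PI * (sqrt Rp * (x - t * Rp)) * y) <= 8 * c * 1).
    { apply Rabs_mult_le; auto. apply Rabs_mult_le. rewrite Rabs_right; lra.
      rewrite Rabs_mult, (Rabs_right (sqrt Rp)) by lra.
      apply Rle_trans with (sqrt Rp * (c / sqrt Rp)). apply Rmult_le_compat_l; lra. right; field; lra. }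
    lra. }
  assert (O := hat_osc_1 phi th (12 * c) H ltac:(unfold th; cont_auto) B).
  set (z := CI _ _ _) in *.
  assert (T : 1 <= Cmod z + Cmod (Cminus z 1)).
  { apply Rle_trans with (Cmod (Cplus z (Copp (Cminus z 1)))).
    right. transitivity (Cmod 1). symmetry; apply Cmod_1. f_equal. ring.
    eapply Rle_trans. apply Cmod_triangle. rewrite Cmod_opp. lra. }
  nra.
Qed.

(** What is left of the phase at frequency [D l + y] once [e((- P l^2 + b l) / q)] is removed, with
    [eps = D x - b / q]. It is affine in [l], so its increments in [l] do not depend on [l]. *)
Definition osc_phase (t D x eps l y : R) : R :=
  - PI * t * y ^ 2 + 2 * PI * (x * y) + 2 * PI * (l * (eps - t * D * y)).

Lemma osc_phase_cont t D x eps l : forall y, continuous (osc_phase t D x eps l) y.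
Proof. unfold osc_phase. cont_auto. Qed.

Lemma block_term phi q P b A k t D x : phi_hyp phi -> (0 < q)%Z -> 0 < D -> t = 2 * IZR P / (D ^ 2 * IZR q) ->
  CI (fun y => Cmult (fourier1 phi y) (expi (- PI * t * (1 * y + D * INR (A + k)) ^ 2 + 2 * PI * (x * (1 * y + D * INR (A + k)))))) (-1) 1
  = Cmult (qterm q P b (Z.of_nat A) k)
     (CI (fun y => Cmult (fourier1 phi y) (expi (osc_phase t D x (D * x - IZR b / IZR q) (INR (A + k)) y))) (-1) 1).
Proof.
  intros H Hq HD Ht. assert (Hq0 : 0 < IZR q) by (apply IZR_lt; lia).
  unfold qterm, eZ. apply CI_expi_shift.
  - apply hat_ccont; auto.
  - apply osc_phase_cont.
  - intros y. unfold osc_phase, quad. rewrite <- Nat2Z.inj_add.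
    rewrite plus_IZR, !mult_IZR, opp_IZR, <- INR_IZR_INZ, Ht. field. lra.
Qed.

Lemma block_lower phi q P b A M t D Rp x c Y : phi_hyp phi -> (0 < q)%Z -> 0 < D -> 1 <= Rp -> 0 < t ->
  4000 * mass phi * c <= 1 -> t * Rp <= c -> Rabs (x - IZR b / (D * IZR q)) <= c / Rp -> 0 <= x <= c ->
  Z.gcd P q = 1%Z -> parity_ok q b ->
  Y = Rp / (D * IZR q) -> 1000 * Rmax 1 (sqrt (ln (IZR q))) <= Y ->
  INR (A + M) <= Rp / D + 1 -> Rp / (2 * D) - 1 <= INR M <= Rp / (2 * D) + 1 ->
  sqrt (IZR q) * Y / 4 <= Cmod (csum (fun k => Cmult (qterm q P b (Z.of_nat A) k)
     (CI (fun y => Cmult (fourier1 phi y) (expi (osc_phase t D x (D * x - IZR b / IZR q) (INR (A + k)) y))) (-1) 1)) M).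
Proof.
  intros H Hq HD HR Ht Hc HtR Hxb Hx HP Hb HY HK HAM HM.
  assert (HPI := PI_RGT_0). assert (HP4 := PI_4). assert (Hm := mass_pos phi H).
  assert (Hq1 : 1 <= IZR q) by (apply IZR_le; lia).
  assert (HY1 : 1000 <= Y). { generalize (Rmax_l 1 (sqrt (ln (IZR q)))). lra. }
  assert (HY2 : 1000 * sqrt (ln (IZR q)) <= Y). { generalize (Rmax_r 1 (sqrt (ln (IZR q)))). lra. }
  assert (HRD : Rp / D = Y * IZR q) by (subst Y; field; lra).
  assert (HRD2 : Rp / (2 * D) = Y * IZR q / 2) by (subst Y; field; lra).
  rewrite HRD in HAM. rewrite HRD2 in HM.
  assert (HRe : Rp = Y * IZR q * D) by (rewrite <- HRD; field; lra).
  (* [W = Rp / D] is the scale of the integer frequencies: the block has at most [W] terms, and all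
     of its indices stay below [2 W]. *)
  set (W := Y * IZR q) in *.
  assert (HW : 1000 <= W) by (unfold W; nra).
  set (eps := D * x - IZR b / IZR q).
  assert (Heps : Rabs eps <= c / W).
  { unfold eps. replace (D * x - IZR b / IZR q) with (D * (x - IZR b / (D * IZR q))) by (field; lra).
    rewrite Rabs_mult, (Rabs_right D) by lra. apply Rle_trans with (D * (c / Rp)).
    apply Rmult_le_compat_l; lra. right. rewrite HRe. field. lra. }
  assert (HtD : t * D <= c / W).
  { apply Rmult_le_reg_r with W. lra. replace (c / W * W) with c by (field; lra).
    rewrite HRe in HtR. lra. }
  assert (HtD0 : 0 < t * D) by nra.
  assert (Hc0 : 0 < c) by nra.
  assert (Htc : t <= c) by nra.
  assert (HcW : 0 < c / W) by (apply Rdiv_lt_0_compat; lra).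
  set (sq := sqrt (IZR q)). assert (Hsq : 0 < sq) by (apply sqrt_lt_R0; lra).
  set (e := 5 * (sq * sqrt (1 + ln (IZR q)))).
  assert (Hln : 0 <= ln (IZR q)). { rewrite <- ln_1. destruct Hq1 as [Hq1|Hq1]. left; apply ln_increasing; lra. rewrite <- Hq1; lra. }
  (* This is where the size of [Y] relative to [sqrt (ln q)] is spent: [1 + sqrt (ln q)] is at most
     [2 * Y / 1000]. *)
  assert (He : e <= sq * Y / 100).
  { assert (S1 : sqrt (1 + ln (IZR q)) <= 1 + sqrt (ln (IZR q))).
    { assert (S0 := sqrt_pos (ln (IZR q))).
      rewrite <- (sqrt_Rsqr (1 + sqrt (ln (IZR q)))) by lra. apply sqrt_le_1_alt. unfold Rsqr.
      generalize (sqrt_sqrt _ Hln). lra. }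
    unfold e. apply Rle_trans with (5 * (sq * (2 * (Y / 1000)))). 2: right; field.
    apply Rmult_le_compat_l. lra. apply Rmult_le_compat_l; lra. }
  assert (QB : forall k, INR k / IZR q <= Y / 2 + 1 -> Cmod (csum (qterm q P b (Z.of_nat A)) k) <= 102 / 100 * (sq * Y)).
  { intros k Hk. destruct (qsum_bounds q P b (Z.of_nat A) k Hq HP Hb) as [_ Q]. cbv zeta in Q. fold sq e in Q.
    assert (2 * (INR k / IZR q) * sq <= 2 * (Y / 2 + 1) * sq). { apply Rmult_le_compat_r; lra. }
    nra. }
  assert (MQ : INR M / IZR q <= Y / 2 + 1 /\ Y / 2 - 1 <= INR M / IZR q).
  { split; apply Rmult_le_reg_r with (IZR q); try lra; replace (INR M / IZR q * IZR q) with (INR M) by (field; lra); unfold W in *; nra. }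
  assert (Lo : 48 / 100 * (sq * Y) <= Cmod (csum (qterm q P b (Z.of_nat A)) M)).
  { destruct (qsum_bounds q P b (Z.of_nat A) M Hq HP Hb) as [Q _]. cbv zeta in Q. fold sq e in Q.
    assert ((Y / 2 - 2) * sq <= (INR M / IZR q - 1) * sq). { apply Rmult_le_compat_r; lra. }
    nra. }
  assert (HsY : 0 < sq * Y) by nra.
  (* The lower bound 48/100 is 1/2 less boundary periods and [e], the upper bound 102/100 is 1 plus
     the same kind of losses. Increments of the phase are at most [8 * 2 c / W]; its value at the
     end is at most [(4 + 8 + 32) c], rounded up to [60 c]. By the choice of [c] the Abel errors
     take less than 4/100, which leaves more than 1/4. *)
  assert (O := abel_lower (qterm q P b (Z.of_nat A))
    (fun k => CI (fun y => Cmult (fourier1 phi y) (expi (osc_phase t D x eps (INR (A + k)) y))) (-1) 1) M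
    (48 / 100 * (sq * Y)) (102 / 100 * (sq * Y)) (2 * mass phi * (16 * (c / W))) (2 * mass phi * (60 * c))).
  eapply Rle_trans; [|apply O; auto; try lra].
  - assert (E1 : INR M * (c / W) <= c).
    { apply Rle_trans with (W * (c / W)). apply Rmult_le_compat_r; lra. right; field; lra. }
    assert (E2 : INR M * (102 / 100 * (sq * Y) * (2 * mass phi * (16 * (c / W)))) <= 102 / 100 * (sq * Y) * (8 / 1000)).
    { replace (INR M * (102 / 100 * (sq * Y) * (2 * mass phi * (16 * (c / W))))) with
        (102 / 100 * (sq * Y) * (32 * mass phi * (INR M * (c / W)))) by ring.
      apply Rmult_le_compat_l. lra. apply Rle_trans with (32 * mass phi * c). apply Rmult_le_compat_l; lra. lra. }
    assert (E3 : 102 / 100 * (sq * Y) * (2 * mass phi * (60 * c)) <= 102 / 100 * (sq * Y) * (30 / 1000)).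
    { apply Rmult_le_compat_l; lra. }
    lra.
  - intros k Hk. apply QB. apply Rle_trans with (INR M / IZR q); [|tauto].
    apply Rmult_le_compat_r. left; apply Rinv_0_lt_compat; lra. apply le_INR; auto.
  - intros k Hk. apply hat_osc; auto; try apply osc_phase_cont.
    intros y Hy. unfold osc_phase. replace (A + S k)%nat with (S (A + k)) by lia. rewrite S_INR.
    match goal with |- Rabs ?u <= _ => replace u with (2 * PI * (eps - t * D * y)) by ring end.
    replace (16 * (c / W)) with (8 * (2 * (c / W))) by ring. apply Rabs_mult_le. rewrite Rabs_right; lra.
    eapply Rle_trans. apply Rabs_triang. rewrite Rabs_Ropp.
    assert (Rabs (t * D * y) <= c / W * 1). { apply Rabs_mult_le. rewrite Rabs_right; lra. apply Rabs_le; lra. }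
    lra.
  - apply hat_osc_1; auto. apply osc_phase_cont.
    intros y Hy. unfold osc_phase.
    assert (Ry : Rabs y <= 1) by (apply Rabs_le; lra).
    eapply Rle_trans. apply Rabs_triang. eapply Rle_trans. apply Rplus_le_compat_r, Rabs_triang.
    assert (B1 : Rabs (- PI * t * y ^ 2) <= 4 * c * 1).
    { apply Rabs_mult_le. 2:{ rewrite <- RPow_abs. simpl. generalize (Rabs_pos y). nra. }
      apply Rabs_mult_le. rewrite Rabs_Ropp, Rabs_right; lra. rewrite Rabs_right; lra. }
    assert (B2 : Rabs (2 * PI * (x * y)) <= 8 * (c * 1)).
    { apply Rabs_mult_le. rewrite Rabs_right; lra. apply Rabs_mult_le; auto. rewrite Rabs_right; lra. }
    assert (B3 : Rabs (2 * PI * (INR (A + M) * (eps - t * D * y))) <= 8 * ((2 * W) * (2 * (c / W)))).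
    { apply Rabs_mult_le. rewrite Rabs_right; lra. apply Rabs_mult_le.
      - rewrite Rabs_right. lra. apply Rle_ge, pos_INR.
      - eapply Rle_trans. apply Rabs_triang. rewrite Rabs_Ropp.
        assert (Rabs (t * D * y) <= c / W * 1). { apply Rabs_mult_le; auto. rewrite Rabs_right; lra. }
        lra. }
    replace (8 * ((2 * W) * (2 * (c / W)))) with (32 * c) in B3 by (field; lra).
    lra.
Qed.

(** * The norm of the initial datum *)

Lemma RtoC_Cmod2 z : RtoC (Cmod z ^ 2) = Cmult z (Cconj z).
Proof. apply Cmod2_conj. Qed.

Lemma csum_ind j c n : csum (fun h => if Nat.eqb h j then c else RtoC 0) n = if Nat.ltb j n then c else RtoC 0.
Proof.
  induction n; auto. simpl csum. rewrite IHn.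
  destruct (Nat.eqb_spec n j), (Nat.ltb_spec j n), (Nat.ltb_spec j (S n)); try lia; ring.
Qed.

(** When the square is expanded, distinct indices differ in frequency by at least [D >= 2] and
    contribute nothing. The value is exact, with no error term. *)
Lemma comb_norm2 phi Q D A M : phi_hyp phi -> 2 <= D -> lineint (fun x => RtoC (phi x ^ 2)) (RtoC Q) ->
  lineint (fun s => RtoC (Cmod (Cmult (RtoC (phi s)) (csum (fun k => expi (2 * PI * D * INR (A + k) * s)) M)) ^ 2))
    (RtoC (INR M * Q)).
Proof.
  intros H HD HQ.
  apply lineint_ext with (f := fun s => csum (fun k => csum (fun k' =>
     Cmult (RtoC (phi s ^ 2)) (expi (2 * PI * (D * (INR k' - INR k) * s)))) M) M).
  - intros s. rewrite RtoC_Cmod2.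
    set (S0 := csum (fun k => expi (2 * PI * D * INR (A + k) * s)) M).
    transitivity (Cmult (RtoC (phi s ^ 2)) (Cmult (Cconj S0) S0)).
    + symmetry. rewrite Cmult_assoc.
      replace (Cmult (RtoC (phi s ^ 2)) (Cconj S0)) with
        (csum (fun k => Cmult (RtoC (phi s ^ 2)) (Cconj (expi (2 * PI * D * INR (A + k) * s)))) M).
      2:{ unfold S0. rewrite csum_conj. apply csum_mult. }
      rewrite Cmult_comm, <- csum_mult. apply csum_ext. intros k _.
      rewrite Cmult_comm. unfold S0. rewrite <- csum_mult. apply csum_ext. intros k' _.
      rewrite expi_conj, <- Cmult_assoc, <- expi_plus. do 2 f_equal. rewrite !plus_INR. ring.
    + rewrite Cmult_conj. simpl pow. rewrite !RtoC_mult. replace (Cconj (RtoC (phi s))) with (RtoC (phi s)) by (apply Ceq; simpl; ring). ring.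
  - replace (RtoC (INR M * Q)) with (csum (fun k => csum (fun k' => if Nat.eqb k' k then RtoC Q else RtoC 0) M) M).
    + apply lineint_csum. intros k Hk. apply lineint_csum. intros k' Hk'.
      destruct (Nat.eqb_spec k' k) as [->|Hn].
      * revert HQ. apply lineint_ext. intros s. rewrite Rminus_diag, Rmult_0_r, Rmult_0_l, Rmult_0_r, expi_0. ring.
      * apply phi2_orthogonal; auto.
        assert (1 <= Rabs (INR k' - INR k)).
        { destruct (Nat.lt_total k' k) as [Hl|[Hl|Hl]]; [| tauto |].
          - apply le_INR in Hl. rewrite S_INR in Hl. rewrite Rabs_left; lra.
          - apply le_INR in Hl. rewrite S_INR in Hl. rewrite Rabs_right; lra. }
        rewrite Rabs_mult, (Rabs_right D) by lra. nra.
    + rewrite (csum_ext _ (fun _ => RtoC Q)).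
      2:{ intros k Hk. rewrite csum_ind. destruct (Nat.ltb_spec k M); auto. lia. }
      assert (P : forall m, csum (fun _ => RtoC Q) m = RtoC (INR m * Q)).
      { induction m. simpl. rewrite Rmult_0_l; auto. simpl csum. rewrite IHm, S_INR, <- RtoC_plus. f_equal. ring. }
      apply P.
Qed.

Lemma gabor_norm2 phi Q Rp : phi_hyp phi -> 0 < Rp -> lineint (fun x => RtoC (phi x ^ 2)) (RtoC Q) ->
  lineint (fun s => RtoC (Cmod (Cmult (expi (2 * PI * Rp * s)) (RtoC (phi (sqrt Rp * s)))) ^ 2)) (RtoC (Q / sqrt Rp)).
Proof.
  intros H HR HQ. assert (Hs0 : 0 < sqrt Rp) by (apply sqrt_lt_R0; lra).
  assert (HC : ccont (fun x => RtoC (phi x ^ 2))).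
  { apply ccont_RtoC. intros x. apply continuous_ext with (f := fun x => phi x * phi x). intros; simpl; ring.
    apply (continuous_mult (K := R_AbsRing)); apply phi_cont, H. }
  assert (L := lineint_comp_lin _ _ (sqrt Rp) 0 Hs0 HC HQ).
  replace (RtoC (Q / sqrt Rp)) with (Cmult (RtoC (/ sqrt Rp)) (RtoC Q)).
  2:{ rewrite <- RtoC_mult. f_equal. unfold Rdiv; ring. }
  revert L. apply lineint_ext. intros s. rewrite Rplus_0_r, Cmod_mult, Cmod_expi, Cmod_R, Rmult_1_l.
  rewrite RPow_abs, Rabs_right; auto. apply Rle_ge, pow2_ge_0.
Qed.

Lemma Cmod_Cprod f k : RtoC (Cmod (Cprod_upto f k) ^ 2) = Cprod_upto (fun j => RtoC (Cmod (f j) ^ 2)) k.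
Proof.
  induction k; cbn [Cprod_upto]. rewrite Cmod_1, pow1. reflexivity.
  rewrite Cmod_mult, Rpow_mult_distr, RtoC_mult, IHk. reflexivity.
Qed.

Lemma Cprod_lower f k B : 0 <= B -> (forall j, (j < k)%nat -> B <= Cmod (f j)) -> B ^ k <= Cmod (Cprod_upto f k).
Proof.
  intros HB. induction k; intros H; simpl. rewrite Cmod_1; lra.
  rewrite Cmod_mult, Rmult_comm. apply Rmult_le_compat; auto. apply pow_le; auto.
Qed.

Lemma Cprod_const c k : Cprod_upto (fun _ => RtoC c) k = RtoC (c ^ k).
Proof. induction k; simpl; auto. rewrite IHk, <- RtoC_mult. f_equal. ring. Qed.

(** Here [V] is the numerator, [L] the norm and [U] the lower bound for one comb factor. For
    [U = sqrt q * Y / 4] the quantity [U ^ 2 * 16 / Y] equals [q Y], a bound for the number of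
    frequencies; written through [U], it lets [q] disappear from the algebra. *)
Lemma ratio_lower_bound Q Rp Y U V L m : 0 < Q -> 0 < Rp -> 0 < Y -> 0 < L ->
  (1 / 2) ^ 2 * (U ^ 2) ^ m <= V ^ 2 -> 0 <= V ->
  L ^ 2 <= Q / sqrt Rp * (U ^ 2 * 16 * Q / Y) ^ m ->
  0 < U ->
  sqrt (/ (4 * Q) * (/ (16 * Q)) ^ m) * Rpower Rp (1 / 4) * Rpower Y (INR m / 2) <= V / L.
Proof.
  intros HQ HR HY HL HV HV0 HLu HU.
  assert (Hs : 0 < sqrt Rp) by (apply sqrt_lt_R0; lra).
  assert (H4 : 0 < / (4 * Q)) by (apply Rinv_0_lt_compat; lra).
  assert (H16 : 0 < / (16 * Q)) by (apply Rinv_0_lt_compat; lra).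
  assert (Hp : 0 < (/ (16 * Q)) ^ m) by (apply pow_lt; auto).
  apply Rmult_le_reg_r with L; auto. replace (V / L * L) with V by (field; lra).
  apply Rsqr_incr_0_var; auto. rewrite !Rsqr_pow2.
  rewrite !Rpow_mult_distr, pow2_sqrt by nra.
  assert (E1 : Rpower Rp (1 / 4) ^ 2 = sqrt Rp).
  { rewrite <- Rpower_sqrt by auto. simpl. rewrite Rmult_1_r, <- Rpower_plus. f_equal. field. }
  assert (E2 : Rpower Y (INR m / 2) ^ 2 = Y ^ m).
  { rewrite <- (Rpower_pow m Y) by auto. simpl. rewrite Rmult_1_r, <- Rpower_plus. f_equal. field. }
  rewrite E1, E2. eapply Rle_trans; [|exact HV].
  apply Rle_trans with (/ (4 * Q) * (/ (16 * Q)) ^ m * sqrt Rp * Y ^ m * (Q / sqrt Rp * (U ^ 2 * 16 * Q / Y) ^ m)).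
  - apply Rmult_le_compat_l; auto. assert (0 < Y ^ m) by (apply pow_lt; auto).
    left. repeat apply Rmult_lt_0_compat; auto.
  - right. replace (/ (4 * Q) * (/ (16 * Q)) ^ m * sqrt Rp * Y ^ m * (Q / sqrt Rp * (U ^ 2 * 16 * Q / Y) ^ m))
      with ((/ (4 * Q) * sqrt Rp * (Q / sqrt Rp)) * ((/ (16 * Q)) ^ m * Y ^ m * (U ^ 2 * 16 * Q / Y) ^ m)) by ring.
    rewrite <- !Rpow_mult_distr.
    replace (/ (4 * Q) * sqrt Rp * (Q / sqrt Rp)) with ((1 / 2) ^ 2) by (field; lra).
    replace (/ (16 * Q) * Y * (U ^ 2 * 16 * Q / Y)) with (U ^ 2) by (field; lra). reflexivity.
Qed.

Definition factor (phi : R -> R) (Rp D : R) (j : nat) (s : R) : C :=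
  match j with
  | O => Cmult (expi (2 * PI * Rp * s)) (RtoC (phi (sqrt Rp * s)))
  | S _ => Cmult (RtoC (phi s)) (Zsum_open (Rp / (2 * D)) (Rp / D) (fun l => expi (2 * PI * D * IZR l * s)))
  end.

Lemma fD_factor m phi Rp D x : fD (S m) phi Rp D x = Cprod_upto (fun j => factor phi Rp D j (x j)) (S m).
Proof.
  rewrite Cprod_S. unfold fD, factor. rewrite Nat.sub_succ, Nat.sub_0_r. reflexivity.
Qed.

Theorem theorem3p2 :
  forall (n : nat) (phi : R -> R),
    (2 <= n)%nat -> phi_hyp phi ->
    exists c0, 0 < c0 /\
    forall c, 0 < c <= c0 ->
    exists K delta Cst, 0 < K /\ 0 < delta /\ 0 < Cst /\
    forall (Rp D : R) (q : Z) (p : nat -> Z) (t : R) (x : nat -> R),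
      K <= Rp -> 0 < D -> (0 < q)%Z ->
      K * Rmax 1 (sqrt (ln (IZR q))) <= Rp / (D * IZR q) ->
      admissible n p q ->
      t = 2 * IZR (p 0%nat) / (D ^ 2 * IZR q) ->
      0 < t -> t <= delta / Rp ->
      in_E n c Rp D q p x -> in_cube n c x ->
      Cst * Rpower Rp (1 / 4) * Rpower (Rp / (D * IZR q)) ((INR n - 1) / 2)
        <= Cmod (schrod n t (fD n phi Rp D) x) / L2norm n (fD n phi Rp D).
Proof.
  intros n phi Hn H. destruct n as [|m]; [lia|].
  assert (Hm := mass_pos phi H).
  destruct (phi2_exists phi H) as [Q [HQ0 HQ]].
  set (c0 := / (4000 * mass phi)).
  assert (Hc0 : 0 < c0) by (apply Rinv_0_lt_compat; lra).
  exists c0. split; auto. intros c Hc.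
  assert (Hmc : 4000 * mass phi * c <= 1).
  { apply Rle_trans with (4000 * mass phi * c0). apply Rmult_le_compat_l; lra. unfold c0. right; field; lra. }
  (* The 1000 feeds the estimate of the exponential sums, and [K >= c] gives [c <= Y], needed for
     [D >= 2]. Taking [delta = c] yields [t * Rp <= c]. *)
  exists (Rmax 1000 c), c, (sqrt (/ (4 * Q) * (/ (16 * Q)) ^ m)).
  split. { generalize (Rmax_l 1000 c); lra. }
  split. { lra. }
  split.
  { apply sqrt_lt_R0, Rmult_lt_0_compat. apply Rinv_0_lt_compat; lra. apply pow_lt, Rinv_0_lt_compat; lra. }
  intros Rp D q p t x HR HD Hq HK Hadm Ht Ht0 Htd HE Hcube.
  assert (HK1000 := Rmax_l 1000 c). assert (HKc := Rmax_r 1000 c).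
  destruct Hadm as (Hgcd & Hev & Hod). destruct HE as [HE0 HEj].
  assert (Hq1 : 1 <= IZR q) by (apply IZR_le; lia).
  set (Y := Rp / (D * IZR q)) in *.
  assert (HM1 := Rmax_l 1 (sqrt (ln (IZR q)))).
  assert (HYK : 1000 * Rmax 1 (sqrt (ln (IZR q))) <= Y).
  { eapply Rle_trans; [|exact HK]. apply Rmult_le_compat_r; lra. }
  assert (HYc : c <= Y) by nra.
  assert (HY : 1000 <= Y) by lra.
  assert (HRD : Rp / D = Y * IZR q) by (unfold Y; field; lra).
  assert (HRY : Rp = Y * IZR q * D) by (unfold Y; field; lra).
  assert (HtR : t * Rp <= c).
  { apply Rmult_le_compat_r with (r := Rp) in Htd; [|lra]. replace (c / Rp * Rp) with c in Htd by (field; lra). auto. }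
  (* t > 0 forces p_1 >= 1, so t R = 2 p_1 Y / D <= c <= Y makes the frequencies 2-separated *)
  assert (HD2 : 2 <= D).
  { assert (E : t * Rp * D = 2 * IZR (p 0%nat) * Y).
    { rewrite Ht, HRY. field. lra. }
    assert (0 < IZR (p 0%nat)).
    { destruct (Rlt_dec 0 (IZR (p 0%nat))); auto. exfalso.
      assert (0 < t * Rp * D). { repeat apply Rmult_lt_0_compat; lra. } nra. }
    assert (1 <= IZR (p 0%nat)). { apply IZR_le. apply lt_IZR in H0. lia. }
    assert (2 * Y <= c * D) by nra. nra. }
  destruct (Zsum_open_csum (Rp / (2 * D)) (Rp / D)) as (A & M & HA & HAM & HM & HZ).
  { left. apply Rdiv_lt_0_compat; lra. }
  { replace (Rp / (2 * D)) with (Rp / D / 2) by (field; lra). rewrite HRD. nra. }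
  assert (HM' : Rp / (2 * D) - 1 <= INR M <= Rp / (2 * D) + 1).
  { replace (Rp / (2 * D)) with (Rp / D / 2) in * by (field; lra). lra. }
  assert (HMpos : 1 <= INR M).
  { replace (Rp / (2 * D)) with (Rp / D / 2) in * by (field; lra). rewrite HRD in *. nra. }
  assert (HMU : INR M <= Y * IZR q).
  { replace (Rp / (2 * D)) with (Rp / D / 2) in * by (field; lra). rewrite HRD in *. nra. }
  assert (Hcomb : forall s, Zsum_open (Rp / (2 * D)) (Rp / D) (fun l => expi (2 * PI * D * IZR l * s)) =
     csum (fun k => expi (2 * PI * D * INR (A + k) * s)) M).
  { intros s. rewrite HZ. apply csum_ext. intros k _. rewrite <- INR_IZR_INZ. reflexivity. }
  set (h := fun j k => match j with
    | O => Cmult (RtoC (/ sqrt Rp)) (fourier1 phi ((k - Rp) / sqrt Rp))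
    | S _ => csum (fun i => Cmult (RtoC (/ 1)) (fourier1 phi ((k - D * INR (A + i)) / 1))) M
    end).
  (* [h] holds the one-dimensional Fourier transforms and [J] the one-dimensional propagated values;
     in coordinates [j >= 1] both are sums over the frequencies of the comb. *)
  set (J := fun j : nat => match j with
    | O => CI (fun y => Cmult (fourier1 phi y) (expi (- PI * t * (sqrt Rp * y + Rp) ^ 2 + 2 * PI * (x 0%nat * (sqrt Rp * y + Rp))))) (-1) 1
    | S _ => csum (fun i => CI (fun y => Cmult (fourier1 phi y) (expi (- PI * t * (1 * y + D * INR (A + i)) ^ 2 + 2 * PI * (x j * (1 * y + D * INR (A + i)))))) (-1) 1) M
    end).
  assert (Hs0 : 0 < sqrt Rp) by (apply sqrt_lt_R0; lra).
  assert (HS : schrod (S m) t (fD (S m) phi Rp D) x = Cprod_upto J (S m)).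
  { apply schrod_prod with (g := factor phi Rp D) (h := h).
    - intros; apply fD_factor.
    - intros [|j] Hj k; unfold factor, h.
      + generalize (hat_gabor phi (sqrt Rp) Rp k H Hs0). apply lineint_ext. intros y.
        rewrite <- (Rmult_assoc (2 * PI) Rp y). reflexivity.
      + apply lineint_ext with (f := fun s => csum (fun i => Cmult (Cmult (expi (2 * PI * (D * INR (A + i) * s))) (RtoC (phi (1 * s)))) (expi (- 2 * PI * (s * k)))) M).
        * intros s. rewrite Hcomb.
          transitivity (Cmult (Cmult (RtoC (phi s)) (expi (- 2 * PI * (s * k)))) (csum (fun i => expi (2 * PI * D * INR (A + i) * s)) M)); [|ring].
          rewrite <- csum_mult. apply csum_ext. intros i _. rewrite Rmult_1_l.
          replace (2 * PI * (D * INR (A + i) * s)) with (2 * PI * D * INR (A + i) * s) by ring. ring.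
        * apply lineint_csum. intros i _. apply hat_gabor; auto. lra.
    - intros [|j] Hj; unfold h, J.
      + apply hat_gabor_schrod; auto.
      + apply lineint_ext with (f := fun k => csum (fun i => Cmult (Cmult (RtoC (/ 1)) (fourier1 phi ((k - D * INR (A + i)) / 1)))
            (expi (- PI * t * k ^ 2 + 2 * PI * (x (S j) * k)))) M).
        * intros k. rewrite (Cmult_comm (csum _ _)), <- csum_mult. apply csum_ext. intros; ring.
        * apply lineint_csum. intros i _. apply hat_gabor_schrod; auto. lra. }
  set (sq := sqrt (IZR q)). assert (Hsq : 0 < sq) by (apply sqrt_lt_R0; lra).
  assert (Hsq2 : sq * sq = IZR q) by (apply sqrt_sqrt; lra).
  set (U := sq * Y / 4).
  assert (HU : 0 < U) by (unfold U; nra).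
  assert (HV : 1 / 2 * U ^ m <= Cmod (schrod (S m) t (fD (S m) phi Rp D) x)).
  { rewrite HS, Cprod_S, Cmod_mult. apply Rmult_le_compat; try lra. left; apply pow_lt; auto.
    - apply (first_factor_lower phi Rp t (x 0%nat) c); auto. lra.
      replace (t * Rp) with (2 * IZR (p 0%nat) * Rp / (IZR q * D ^ 2)) by (rewrite Ht; field; lra). auto.
    - apply Cprod_lower. lra. intros j Hj. unfold J.
      rewrite (csum_ext _ _ M (fun i _ => block_term phi q (p 0%nat) (p (S j)) A i t D (x (S j)) H Hq HD Ht)).
      apply (block_lower phi q (p 0%nat) (p (S j)) A M t D Rp (x (S j)) c Y); auto; try lra.
      + apply HEj. lia.
      + apply Hcube. lia.
      + split; intros Hmod; [apply Hev | apply Hod]; auto; lia. }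
  assert (HL2 : L2norm (S m) (fD (S m) phi Rp D) = sqrt (Q / sqrt Rp * (INR M * Q) ^ m)).
  { unfold L2norm. f_equal.
    rewrite (integral_Rn_prod (S m) _ (fun j s => RtoC (Cmod (factor phi Rp D j s) ^ 2))
      (fun j => match j with O => RtoC (Q / sqrt Rp) | S _ => RtoC (INR M * Q) end)).
    - rewrite Cprod_S, Cprod_const, <- RtoC_mult. reflexivity.
    - intros y. rewrite fD_factor. apply Cmod_Cprod.
    - intros [|j] Hj; unfold factor.
      + apply gabor_norm2; auto. lra.
      + generalize (comb_norm2 phi Q D A M H HD2 HQ). apply lineint_ext. intros s. rewrite Hcomb. reflexivity. }
  assert (HQM : 0 < (INR M * Q) ^ m) by (apply pow_lt; nra).
  assert (HQR : 0 < Q / sqrt Rp) by (apply Rdiv_lt_0_compat; lra).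
  replace (INR (S m) - 1) with (INR m) by (rewrite S_INR; ring).
  apply ratio_lower_bound with (U := U); auto; try lra.
  - rewrite HL2. apply sqrt_lt_R0. apply Rmult_lt_0_compat; auto.
  - replace ((1 / 2) ^ 2 * (U ^ 2) ^ m) with ((1 / 2 * U ^ m) ^ 2).
    2:{ rewrite Rpow_mult_distr, <- !pow_mult. f_equal. f_equal. lia. }
    apply pow_incr. split; auto. assert (0 < U ^ m) by (apply pow_lt; auto). lra.
  - apply Cmod_ge_0.
  - rewrite HL2, pow2_sqrt by nra. apply Rmult_le_compat_l. lra.
    apply pow_incr. split. nra.
    (* The claim reduces to [INR M <= Y * IZR q]: the comb has at most [Rp / D] frequencies. *)
    replace (U ^ 2 * 16 * Q / Y) with (sq * sq * Y * Q) by (unfold U; field; lra).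
    rewrite Hsq2. apply Rmult_le_compat_r; lra.
Qed.
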